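(* Let $s$ and $k$ be integers with $s$ even and $s>2k\ge 0$, and let $R_s(x,y)$ be a real homogeneous polynomial of degree $s$. Consider the planar system $$ \begin{array}{rcl} \dot x&=&-y(x^2+y^2)^{k}+xR_s(x,y),\\ \dot y&=&\phantom{-}x(x^2+y^2)^{k}+yR_s(x,y). \end{array} $$ Let $\Gamma\subset\mathbb{R}^2$ be a spiral trajectory of this system near the focus at the origin. Then $$ \dim_B\Gamma=2-\frac{2}{s-2k+1}, $$ and $\Gamma$ is Minkowski nondegenerate.
   Context: Spiral trajectory near the focus: the origin is a singular point of focus type, and $\Gamma$ is a nonconstant half-trajectory, contained in a bounded neighbourhood of the origin, which converges to the origin (as time tends to $+\infty$ or to $-\infty$) while winding around it infinitely many times. Box dimension. For a bounded set $A\subset\mathbb{R}^N$ (here $N=2$) and $\varepsilon>0$, let $A_\varepsilon:=\{y\in\mathbb{R}^N : d(y,A)<\varepsilon\}$ and let $|A_\varepsilon|$ be its $N$-dimensional Lebesgue measure. For $\sigma\ge 0$ the lower and upper $\sigma$-dimensional Minkowski contents are $$\mathcal{M}_*^\sigma(A):=\liminf_{\varepsilon\to0}\frac{|A_\varepsilon|}{\varepsilon^{N-\sigma}},\qquad \mathcal{M}^{*\sigma}(A):=\limsup_{\varepsilon\to0}\frac{|A_\varepsilon|}{\varepsilon^{N-\sigma}}.$$ The lower and upper box dimensions are $\underline{\dim}_BA:=\inf\{\sigma\ge0:\mathcal{M}_*^\sigma(A)=0\}$ and $\overline{\dim}_BA:=\inf\{\sigma\ge0:\mathcal{M}^{*\sigma}(A)=0\}$.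 If they coincide, the common value is the box dimension $\dim_BA$. The set $A$ is Minkowski nondegenerate if $0<\mathcal{M}_*^d(A)\le\mathcal{M}^{*d}(A)<\infty$ for some $d$ (in which case $d=\dim_BA$). *)

(* Defs.v *)
From HB Require Import structures.
From mathcomp Require Import all_boot all_order all_algebra.
From mathcomp Require Import all_classical all_reals all_analysis.
(* The notations of [mpoly] clash with those of MathComp-Analysis. *)
From mathcomp Require Import -(notations) mpoly.
Set Implicit Arguments.
Unset Strict Implicit.
Unset Printing Implicit Defensive.
Import Order.TTheory GRing.Theory Num.Theory.
Import numFieldNormedType.Exports.
Local Open Scope classical_set_scope.
Local Open Scope ring_scope.

(* The canonical norm of [R * R] is the maximum norm; distances in the plane
   are Euclidean here. *)
Definition enorm (R : realType) (p : R * R) : R :=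
  Num.sqrt (p.1 ^+ 2 + p.2 ^+ 2).

(* Extended-real valued, so that the distance to the empty set is [+oo]. *)
Definition dist_to (R : realType) (A : set (R * R)) (p : R * R) : \bar R :=
  ereal_inf [set (enorm (p - a))%:E | a in A].

Definition nbhd (R : realType) (A : set (R * R)) (e : R) : set (R * R) :=
  [set p | (dist_to A p < e%:E)%E].

Definition area (R : realType) : set (R * R) -> \bar R :=
  (lebesgue_measure \x lebesgue_measure)%E.

Definition minkowski_quotient (R : realType) (A : set (R * R)) (sigma : R)
    (e : R) : \bar R :=
  (area (nbhd A e) / (e `^ (2 - sigma))%:E)%E.

Definition lower_minkowski_content (R : realType) (sigma : R)
    (A : set (R * R)) : \bar R :=
  limf_einf (minkowski_quotient A sigma) 0^'+.

Definition upper_minkowski_content (R : realType) (sigma : R)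
    (A : set (R * R)) : \bar R :=
  limf_esup (minkowski_quotient A sigma) 0^'+.

Definition lower_box_dim (R : realType) (A : set (R * R)) : \bar R :=
  ereal_inf [set sigma%:E | sigma in
    [set sigma : R | 0 <= sigma /\ lower_minkowski_content sigma A = 0%E]].

Definition upper_box_dim (R : realType) (A : set (R * R)) : \bar R :=
  ereal_inf [set sigma%:E | sigma in
    [set sigma : R | 0 <= sigma /\ upper_minkowski_content sigma A = 0%E]].

Definition has_box_dim (R : realType) (A : set (R * R)) (d : R) : Prop :=
  lower_box_dim A = d%:E /\ upper_box_dim A = d%:E.

Definition minkowski_nondegenerate (R : realType) (A : set (R * R)) : Prop :=
  exists d : R,
    [/\ 0 <= d,
        (0 < lower_minkowski_content d A)%E,
        (lower_minkowski_content d A <= upper_minkowski_content d A)%E &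
        (upper_minkowski_content d A < +oo)%E].

(* A half-trajectory runs over [t0, +oo[ ([fwd = true]) or over ]-oo, t0]. *)
Definition time_ray (R : realType) (fwd : bool) (t0 : R) : set R :=
  if fwd then `[t0, +oo[%classic else `]-oo, t0]%classic.

Definition time_end (R : realType) (fwd : bool) : set_system R :=
  if fwd then pinfty_nbhs R else ninfty_nbhs R.

(* Two-sided derivatives are asked for at [t0] as well: the values of [g]
   outside the ray are irrelevant, and a solution on the closed ray can always
   be extended beyond [t0] so as to be differentiable there. *)
Definition solution_on_ray (R : realType) (F : R * R -> R * R) (fwd : bool)
    (t0 : R) (g : R -> R * R) : Prop :=
  forall t : R, time_ray fwd t0 t ->
    is_derive t 1 (fun u => (g u).1) (F (g t)).1 /\
    is_derive t 1 (fun u => (g u).2) (F (g t)).2.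

(* [theta] is a continuous determination of the polar angle along [g]; winding
   infinitely many times means that [|theta|] tends to infinity. *)
Definition winds_infinitely (R : realType) (fwd : bool) (t0 : R)
    (g : R -> R * R) : Prop :=
  (forall t, time_ray fwd t0 t -> g t <> (0, 0)) /\
  exists theta : R -> R,
    [/\ {within time_ray fwd t0, continuous theta},
        forall t, time_ray fwd t0 t ->
          g t = (enorm (g t) * cos (theta t), enorm (g t) * sin (theta t)) &
        `|theta t| @[t --> time_end fwd] --> +oo].

Definition spirals_to_origin (R : realType) (fwd : bool) (t0 : R)
    (g : R -> R * R) : Prop :=
  g t @[t --> time_end fwd] --> ((0, 0) : R * R) /\
  winds_infinitely fwd t0 g.

(* All orbits close to the origin spiral to it, in the same time direction:
   the focus is stable if [fwd = true] and unstable if [fwd = false]. *)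
Definition focus_at_origin (R : realType) (F : R * R -> R * R) : Prop :=
  F (0, 0) = (0, 0) /\
  exists (fwd : bool) (delta : R), 0 < delta /\
    forall p : R * R, 0 < enorm p < delta ->
      exists (t0 : R) (g : R -> R * R),
        [/\ g t0 = p, solution_on_ray F fwd t0 g & spirals_to_origin fwd t0 g].

Definition spiral_trajectory (R : realType) (F : R * R -> R * R)
    (Gamma : set (R * R)) : Prop :=
  focus_at_origin F /\
  exists (fwd : bool) (t0 : R) (g : R -> R * R),
    [/\ solution_on_ray F fwd t0 g,
        Gamma = g @` time_ray fwd t0,
        exists2 t, time_ray fwd t0 t & g t <> g t0,
        bounded_set Gamma &
        spirals_to_origin fwd t0 g].

Definition eval2 (R : realType) (P : mpoly.mpoly 2 R) (x y : R) : R :=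
  mpoly.meval (tnth [tuple x; y]) P.

(* The zero polynomial is homogeneous of every degree. *)
Definition homogeneous (R : realType) (s : nat) (P : mpoly.mpoly 2 R) : Prop :=
  P \is mpoly.ishomog1 s mpoly.mdeg.

Definition planar_field (R : realType) (k : nat) (P : mpoly.mpoly 2 R)
    (p : R * R) : R * R :=
  let: (x, y) := p in
  (- y * (x ^+ 2 + y ^+ 2) ^+ k + x * eval2 P x y,
   x * (x ^+ 2 + y ^+ 2) ^+ k + y * eval2 P x y).

(* Main.v *)
Require Import Defs.
From mathcomp Require Import all_boot all_order all_algebra.
From mathcomp Require Import all_classical all_reals all_analysis.
From mathcomp Require mpoly.
From mathcomp Require Import -(notations) mpoly.
From mathcomp Require Import ring lra.
Set Implicit Arguments.
Unset Strict Implicit.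
Unset Printing Implicit Defensive.
Import Order.TTheory GRing.Theory Num.Theory.
Import numFieldNormedType.Exports.
Local Open Scope classical_set_scope.
Local Open Scope ring_scope.

(** Put [m = s - 2 * k], an even positive number, and [d = 2 - 2 / (m + 1)].  In
polar coordinates the system reads [r' = r ^ (s + 1) * f phi] and
[phi' = r ^ (2 * k)], where [f phi = R_s (cos phi, sin phi)]; so along an orbit
the quantity [v = r ^ -m] is a function of the angle with
[dv / dphi = - m * f phi].  As [f] is bounded and [2 * pi]-periodic, [v] is
Lipschitz and increases by the same amount [kappa] at each turn; [kappa] is
positive because the orbit tends to the origin ([inverse_radius]).  Hence the
radius decreases like [phi ^ (- 1 / m)], and successive turns at distance [a]
from the origin lie at a distance of order [a ^ (m + 1)] from each other.

The area of the [eps]-neighbourhood is then of the exact order of [r ^ 2], where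
[eps = r ^ (m + 1)], i.e. [r ^ 2 = eps ^ (2 - d)].  The radius [r] is the one
below which the turns are less than about [eps] apart.
- From below ([nbhd_contains_square]): near the origin the neighbourhood has no
  gap between turns, so it contains a square of side comparable to [r].
- From above ([area_nbhd_spiral_le]): the turns of index at least [N], with [N]
  of order [r ^ -m], lie in one square of side comparable to [r].  The turn of
  index [n < N] is covered by about [B n / eps] squares of side comparable to
  [eps], where [B n] bounds its radius up to a constant; [m >= 2] makes the sum
  of the [B n] at most of order [r ^ (1 - m)], so that these squares contribute
  [eps * r ^ (1 - m) = r ^ 2] as well.

Such a two-sided estimate of the area settles both the box dimension and
Minkowski nondegeneracy ([box_dim_of_area_bounds]). *)

(** * Minkowski contents from two-sided bounds on the area *)

Section contents.
Variable R : realType.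
Implicit Types (f : R -> \bar R) (A : set (R * R)).

Lemma limf_esup_le_near f (c : \bar R) :
  (\forall e \near (0:R)^'+, (f e <= c)%E) -> (limf_esup f 0^'+ <= c)%E.
Proof.
move=> fc; rewrite limf_esupE; apply: ge_ereal_inf.
exists (ereal_sup (f @` [set e | (f e <= c)%E])); first by exists [set e | (f e <= c)%E].
by apply: ge_ereal_sup => _ [e /= fe <-].
Qed.

Lemma limf_einf_ge_near f (c : \bar R) :
  (\forall e \near (0:R)^'+, (c <= f e)%E) -> (c <= limf_einf f 0^'+)%E.
Proof.
move=> fc; rewrite limf_einfE; apply: le_ereal_sup_tmp.
exists (ereal_inf (f @` [set e | (c <= f e)%E])); first by exists [set e | (c <= f e)%E].
by apply: le_ereal_inf_tmp => _ [e /= fe <-].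
Qed.

Lemma limf_einf_le_esup f : (limf_einf f (0:R)^'+ <= limf_esup f 0^'+)%E.
Proof.
rewrite limf_einfE limf_esupE; apply: ge_ereal_sup => _ [V FV <-].
apply: le_ereal_inf_tmp => _ [W FW <-].
have [e [Ve We]] : V `&` W !=set0 by apply: (@filter_ex _ (0:R)^'+); apply: filterI.
apply: (@le_trans _ _ (f e)); first by apply: ereal_inf_lbound; exists e.
by apply: ereal_sup_ubound; exists e.
Qed.

Lemma minkowski_quotientE A (sigma e : R) : 0 < e ->
  minkowski_quotient A sigma e = (area (nbhd A e) * (e `^ (sigma - 2))%:E)%E.
Proof.
move=> e0; rewrite /minkowski_quotient inver gt_eqF ?powR_gt0//.
by rewrite -powRN opprB.
Qed.

Section two_sided.
Variables (A : set (R * R)) (d c C e0 : R).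
Hypotheses (e00 : 0 < e0) (c0 : 0 < c) (C0 : 0 < C) (d0 : 0 <= d).
Hypothesis bounds : forall e, 0 < e < e0 ->
  ((c * e `^ (2 - d))%:E <= area (nbhd A e) <= (C * e `^ (2 - d))%:E)%E.

Lemma quotient_bounds (sigma e : R) : 0 < e < e0 ->
  ((c * e `^ (sigma - d))%:E <= minkowski_quotient A sigma e
     <= (C * e `^ (sigma - d))%:E)%E.
Proof.
move=> ee; have /andP[e_gt0 _] := ee; rewrite minkowski_quotientE//.
have E (b : R) : (b * e `^ (sigma - d))%:E =
    ((b * e `^ (2 - d))%:E * (e `^ (sigma - 2))%:E)%E.
  rewrite -EFinM -mulrA -powRD; last by rewrite (gt_eqF e_gt0) implybT.
  by congr (_ * _ `^ _)%:E; ring.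
have /andP[lo hi] := bounds ee.
by rewrite !E; apply/andP; split; apply: lee_wpmul2r; rewrite ?lee_fin ?powR_ge0.
Qed.

Lemma near0_lt (e1 : R) : 0 < e1 -> \forall e \near (0:R)^'+, 0 < e < e1.
Proof.
move=> e10; near=> e; apply/andP; split; near: e; first exact: nbhs_right_gt.
exact: nbhs_right_lt.
Unshelve. all: by end_near. Qed.

(** For [eps <= 1] and [sigma <= d] the factor [eps ^ (sigma - d)] of
[quotient_bounds] is at least [1]. *)
Lemma lower_content_gt0 (sigma : R) : sigma <= d ->
  (0 < lower_minkowski_content sigma A)%E.
Proof.
move=> sd; apply: (@lt_le_trans _ _ c%:E); first by rewrite lte_fin.
have e1 : 0 < Num.min e0 1 by rewrite lt_min e00 ltr01.
apply: limf_einf_ge_near; apply: filterS (near0_lt e1) => e.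
rewrite lt_min => /andP[e_gt0 /andP[e_e0 e_1]].
have /andP[lo _] : _ := quotient_bounds sigma (introT andP (conj e_gt0 e_e0)).
apply: le_trans lo; rewrite lee_fin ler_peMr ?(ltW c0)//.
rewrite -(powRr0 e); apply: ger_powR; first by rewrite e_gt0 ltW.
by rewrite subr_le0.
Qed.

Lemma upper_content_fin : (upper_minkowski_content d A <= C%:E)%E.
Proof.
apply: limf_esup_le_near; apply: filterS (near0_lt e00) => e ee.
have /andP[_] := quotient_bounds d ee.
by rewrite subrr powRr0 mulr1.
Qed.

Lemma lower_content_ge0 (sigma : R) : (0 <= lower_minkowski_content sigma A)%E.
Proof.
apply: limf_einf_ge_near; apply: filterS (near0_lt e00) => e ee.
have /andP[+ _] := quotient_bounds sigma ee.
by apply: le_trans; rewrite lee_fin mulr_ge0 ?powR_ge0 ?(ltW c0).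
Qed.

Lemma upper_content_eq0 (sigma : R) : d < sigma ->
  upper_minkowski_content sigma A = 0%E.
Proof.
move=> ds; apply/eqP; rewrite eq_le; apply/andP; split; last first.
  exact: le_trans (lower_content_ge0 sigma) (limf_einf_le_esup _).
apply/lee_addgt0Pr => h h0; rewrite add0e.
have p0 : 0 < sigma - d by rewrite subr_gt0.
apply: limf_esup_le_near.
have := @powR_cvg0 R _ p0 => /cvgrPdist_lt /(_ (h / C)).
rewrite divr_gt0// => /(_ isT) H.
near=> e.
have /andP[_ hi] : ((c * e `^ (sigma - d))%:E <= minkowski_quotient A sigma e
     <= (C * e `^ (sigma - d))%:E)%E.
  by apply: quotient_bounds; near: e; exact: near0_lt.
apply: le_trans hi _; rewrite lee_fin mulrC -ler_pdivlMr//.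
have : `|0 - e `^ (sigma - d)| < h / C by near: e; exact: H.
by rewrite sub0r normrN ger0_norm ?powR_ge0// => /ltW.
Unshelve. all: by end_near. Qed.

Lemma ereal_inf_threshold (S : set R) :
  (forall s, S s -> d <= s) -> (forall s, d < s -> S s) ->
  ereal_inf [set s%:E | s in S] = d%:E.
Proof.
move=> lo hi; apply/eqP; rewrite eq_le; apply/andP; split.
  apply/lee_addgt0Pr => h h0; rewrite -EFinD.
  by apply: ereal_inf_lbound; exists (d + h) => //; apply: hi; rewrite ltrDl.
by apply: le_ereal_inf_tmp => _ [s Ss <-]; rewrite lee_fin lo.
Qed.

(** Both contents are positive up to [d] and vanish beyond [d]. *)
Lemma box_dim_of_area_bounds : has_box_dim A d /\ minkowski_nondegenerate A.
Proof.
split; last first.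
  exists d; split=> //; first exact: lower_content_gt0.
    exact: limf_einf_le_esup.
  exact: le_lt_trans upper_content_fin (ltry _).
have lo s : lower_minkowski_content s A = 0%E -> d <= s.
  by rewrite leNgt => s0; apply/negP => /ltW/lower_content_gt0; rewrite s0 ltxx.
split; apply: ereal_inf_threshold.
- by move=> s [_ /lo].
- move=> s ds; split; first exact: le_trans d0 (ltW ds).
  apply/eqP; rewrite eq_le lower_content_ge0 andbT -(upper_content_eq0 ds).
  exact: limf_einf_le_esup.
- move=> s [_ us]; apply: lo; apply/eqP; rewrite eq_le lower_content_ge0 andbT.
  by rewrite -us; exact: limf_einf_le_esup.
- by move=> s ds; split; [exact: le_trans d0 (ltW ds)|exact: upper_content_eq0].
Qed.
End two_sided.
End contents.

(** * Squares, neighbourhoods and planar area *)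

Section plane.
Variable R : realType.
Implicit Types (p q : R * R) (A : set (R * R)).

Lemma enorm_ge0 p : 0 <= enorm p.
Proof. exact: sqrtr_ge0. Qed.

Lemma sqr_enorm p : enorm p ^+ 2 = p.1 ^+ 2 + p.2 ^+ 2.
Proof. by rewrite sqr_sqrtr// addr_ge0 ?sqr_ge0. Qed.

Lemma normr_fst_le_enorm p : `|p.1| <= enorm p.
Proof. by rewrite -sqrtr_sqr ler_wsqrtr// lerDl sqr_ge0. Qed.

Lemma normr_snd_le_enorm p : `|p.2| <= enorm p.
Proof. by rewrite -sqrtr_sqr ler_wsqrtr// lerDr sqr_ge0. Qed.

Lemma enorm_le_sum p : enorm p <= `|p.1| + `|p.2|.
Proof.
rewrite -(ler_pXn2r (n := 2))// ?nnegrE ?enorm_ge0 ?addr_ge0//.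
rewrite sqr_enorm -(real_normK (num_real p.1)) -(real_normK (num_real p.2)).
have := mulr_ge0 (normr_ge0 p.1) (normr_ge0 p.2); lra.
Qed.

Lemma enormD p q : enorm (p + q) <= enorm p + enorm q.
Proof.
rewrite -(ler_pXn2r (n := 2))// ?nnegrE ?enorm_ge0 ?addr_ge0 ?enorm_ge0//.
rewrite sqrrD !sqr_enorm /=.
suff : p.1 * q.1 + p.2 * q.2 <= enorm p * enorm q by lra.
apply: (le_trans (ler_norm _)).
rewrite -(ler_pXn2r (n := 2))// ?nnegrE ?mulr_ge0 ?enorm_ge0//.
rewrite real_normK ?num_real// exprMn !sqr_enorm.
have := sqr_ge0 (p.1 * q.2 - p.2 * q.1); lra.
Qed.

Lemma nbhdP A (e : R) p : nbhd A e p <-> exists2 a, A a & enorm (p - a) < e.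
Proof.
split.
  by move/ereal_inf_ltP => [_ [a Aa <-]]; rewrite lte_fin => ?; exists a.
by move=> [a Aa pa]; apply/ereal_inf_ltP; exists (enorm (p - a))%:E => //; exists a.
Qed.

(** The real line carries several definitionally different measurable
structures; this is the one on which the planar measure is built. *)
Local Notation plane_measurable A :=
  (@measurable _ (measurableTypeR R * measurableTypeR R)%type A).

Definition square p (h : R) : set (R * R) :=
  `[p.1 - h, p.1 + h] `*` `[p.2 - h, p.2 + h].

Lemma squareP p h q :
  square p h q <-> (`|q.1 - p.1| <= h) /\ (`|q.2 - p.2| <= h).
Proof.
by rewrite !ler_distl /square /=; split => -[]; rewrite !in_itv.
Qed.

Lemma measurable_square p h : plane_measurable (square p h).
Proof. exact: measurableX. Qed.

Lemma area_square p (h : R) : 0 <= h -> area (square p h) = ((2 * h) ^+ 2)%:E.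
Proof.
move=> h0; rewrite /area product_measure1E//= !lebesgue_measure_itv/= !lte_fin.
have E x : x + h - (x - h) = 2 * h by ring.
case: ltP => h1; last by have -> : h = 0 by [lra]; rewrite mulr0 expr0n mul0e.
rewrite (_ : _ < _) ?EFinN -?EFinB ?E -?EFinM ?expr2//; lra.
Qed.

(** The neighbourhood is a union of open discs, hence the countable union of the
squares with rational centre and rational half-side that it contains. *)
Lemma measurable_nbhd A (e : R) : plane_measurable (nbhd A e).
Proof.
pose F (i : rat * rat * rat) :=
  let S := square (ratr i.1.1, ratr i.1.2) (ratr i.2) in
  if `[< S `<=` nbhd A e >] then S else set0.
have -> : nbhd A e = \bigcup_i F i.
  apply/seteqP; split=> [p /nbhdP[a Aa pa]|p [i _]]; last first.
    by rewrite /F; case: asboolP => // h /h.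
  pose h := (e - enorm (p - a)) / 8.
  have h0 : 0 < h by rewrite divr_gt0// subr_gt0.
  have [|q1 q1p] := @rat_in_itvoo R (p.1 - h) (p.1 + h); first by lra.
  have [|q2 q2p] := @rat_in_itvoo R (p.2 - h) (p.2 + h); first by lra.
  have [|r rh] := @rat_in_itvoo R h (2 * h); first by lra.
  move: q1p q2p rh; rewrite !in_itv/= => /andP[q1l q1r] /andP[q2l q2r] /andP[rl rr].
  exists (q1, q2, r) => //; rewrite /F/=.
  case: asboolP => [_|[]].
    by apply/squareP; split; rewrite ler_distl /=; apply/andP; split; lra.
  move=> z /squareP[/=]; rewrite !ler_distl => /andP[z1l z1r] /andP[z2l z2r].
  apply/nbhdP; exists a => //; rewrite -(subrKA p); apply: (le_lt_trans (enormD _ _)).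
  rewrite -ltrBrDr; apply: (le_lt_trans (enorm_le_sum _)) => /=.
  have d1 : `|z.1 - p.1| < 4 * h by rewrite ltr_distl; apply/andP; split; lra.
  have d2 : `|z.2 - p.2| < 4 * h by rewrite ltr_distl; apply/andP; split; lra.
  by have : e - enorm (p - a) = 8 * h by [rewrite /h; field]; lra.
apply: countable_bigcupT_measurable => // i; rewrite /F.
by case: ifP => _; [exact: measurable_square|exact: measurable0].
Qed.

Lemma le_area A B : plane_measurable A -> plane_measurable B -> A `<=` B ->
  (area A <= area B)%E.
Proof.
move=> mA mB AB.
have := @le_measure _ R _ ((@lebesgue_measure R) \x (@lebesgue_measure R))%E A B.
by rewrite !inE => /(_ mA mB AB); exact.
Qed.

Lemma area_setU A B : plane_measurable A -> plane_measurable B ->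
  (area (A `|` B) <= area A + area B)%E.
Proof.
move=> mA mB.
have := @measureU2 _ _ _ ((@lebesgue_measure R) \x (@lebesgue_measure R))%E A B mA mB.
exact.
Qed.

Lemma area_bigsetU (A : nat -> set (R * R)) n :
  (forall i, (i < n)%N -> plane_measurable (A i)) ->
  (area (\big[setU/set0]_(i < n) A i) <= \sum_(i < n) area (A i))%E.
Proof.
move=> mA.
have := @Boole_inequality _ _ _ ((@lebesgue_measure R) \x (@lebesgue_measure R))%E A n mA.
exact.
Qed.

Lemma area_ge_square A p (h : R) : 0 <= h -> plane_measurable A ->
  square p h `<=` A -> (((2 * h) ^+ 2)%:E <= area A)%E.
Proof.
move=> h0 mA sA; rewrite -(area_square p h0); apply: le_area => //.
exact: measurable_square.
Qed.

Lemma area_le_cover A p0 (h0 h : R) (N : nat) (M : nat -> nat)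
    (c : nat -> nat -> R * R) :
  0 <= h0 -> 0 <= h -> plane_measurable A ->
  (forall p, A p -> square p0 h0 p \/
     exists n i, [/\ (n < N)%N, (i < M n)%N & square (c n i) h p]) ->
  (area A <= ((2 * h0) ^+ 2 + \sum_(n < N) (M n)%:R * (2 * h) ^+ 2)%:E)%E.
Proof.
move=> h00 hh mA cov.
pose T n := \big[setU/set0]_(i < M n) square (c n i) h.
have mT n : plane_measurable (T n).
  by apply: bigsetU_measurable => i _; exact: measurable_square.
pose U := square p0 h0 `|` \big[setU/set0]_(n < N) T n.
have mU : plane_measurable (\big[setU/set0]_(n < N) T n).
  by apply: bigsetU_measurable => n _.
apply: (@le_trans _ _ (area U)).
  apply: le_area => //; first by apply: measurableU => //; exact: measurable_square.
  move=> p /cov[?|[n [i [nN iM pn]]]]; first by left.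
  right; have := bigcup_mkord N T => <-; exists n => //=.
  by rewrite /T -(bigcup_mkord (M n) (fun i => square (c n i) h)); exists i.
apply: le_trans (area_setU _ mU) _; first exact: measurable_square.
rewrite EFinD; apply: leeD; first by rewrite -(area_square p0 h00).
apply: (le_trans (@area_bigsetU T N _)) => //.
rewrite -sumEFin; apply: lee_sum => n _.
apply: (le_trans (@area_bigsetU (fun i => square (c n i) h) (M n) _)) => //.
  by move=> i _; exact: measurable_square.
rewrite (eq_bigr (fun=> ((2 * h) ^+ 2)%:E)); last first.
  by move=> i _; exact: area_square.
by rewrite sumEFin sumr_const card_ord (mulr_natl ((2 * h) ^+ 2)).
Qed.
End plane.

(** * Elementary real analysis *)

Section real_lemmas.
Variable R : realType.

(** Continuity is one-sided at the ends of the segment: along a half-trajectory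
the angle is only known to be continuous on the closed ray. *)
Lemma mean_value_bound (f df : R -> R) (a b L : R) : a <= b ->
  (forall x, a < x < b -> is_derive x 1 f (df x)) ->
  {within `[a, b], continuous f} ->
  (forall x, a < x < b -> `|df x| <= L) ->
  `|f b - f a| <= L * (b - a).
Proof.
rewrite le_eqVlt => /orP[/eqP <- _ _ _|ab dfP fc dfL].
  by rewrite !subrr normr0 mulr0.
have dfP' x : x \in `]a, b[%R -> is_derive x 1 f (df x).
  by rewrite in_itv /=; exact: dfP.
have [c cab ->] := MVT ab dfP' fc.
rewrite normrM (ger0_norm (x := b - a)) ?subr_ge0 ?(ltW ab)//.
by rewrite ler_wpM2r ?subr_ge0 ?(ltW ab)// dfL// -in_itv.
Qed.

Lemma lipschitz_of_derive (f df : R -> R) (c L a b : R) :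
  (forall x, c < x -> is_derive x 1 f (df x)) ->
  (forall x, c < x -> `|df x| <= L) ->
  c < a -> c < b -> `|f a - f b| <= L * `|a - b|.
Proof.
move=> dfP dfL.
wlog ab : a b / b <= a => [H ca cb|ca cb].
  have [ba|/ltW ab] := leP b a; first exact: H.
  by rewrite distrC (distrC a); exact: H.
rewrite (ger0_norm (x := a - b)) ?subr_ge0//.
apply: (@mean_value_bound _ df _ _ _ ab).
- by move=> x /andP[bx _]; apply: dfP; exact: lt_trans bx.
- apply: derivable_within_continuous => x; rewrite in_itv/= => /andP[bx _].
  by have [] := dfP x (lt_le_trans cb bx).
- by move=> x /andP[bx _]; apply: dfL; exact: lt_trans bx.
Qed.

Lemma lipschitz_cos (a b : R) : `|cos a - cos b| <= `|a - b|.
Proof.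
rewrite -[leRHS]mul1r.
apply: (@lipschitz_of_derive cos (fun x => - sin x) (Num.min a b - 1)).
- by move=> x _; rewrite normrN ler_norml sin_geN1 sin_le1.
- by rewrite ltrBlDr (le_lt_trans (y := a))// ?ltrDl // ge_min lexx ?orbT.
- by rewrite ltrBlDr (le_lt_trans (y := b))// ?ltrDl // ge_min lexx ?orbT.
Qed.

Lemma lipschitz_sin (a b : R) : `|sin a - sin b| <= `|a - b|.
Proof.
rewrite -[leRHS]mul1r.
apply: (@lipschitz_of_derive sin (fun x => cos x) (Num.min a b - 1)).
- by move=> x _; rewrite ler_norml cos_geN1 cos_le1.
- by rewrite ltrBlDr (le_lt_trans (y := a))// ?ltrDl // ge_min lexx ?orbT.
- by rewrite ltrBlDr (le_lt_trans (y := b))// ?ltrDl // ge_min lexx ?orbT.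
Qed.

Lemma unit_vector_angle (c s : R) : c ^+ 2 + s ^+ 2 = 1 ->
  exists2 b, - pi <= b <= pi & c = cos b /\ s = sin b.
Proof.
move=> cs1.
have c1 : -1 <= c <= 1.
  by rewrite -ler_norml -(ler_pXn2r (n := 2))// ?nnegrE// expr1n
    real_normK ?num_real// -cs1 lerDl sqr_ge0.
have sE : sin (acos c) = `|s|.
  by rewrite sin_acos// -sqrtr_sqr -cs1; congr Num.sqrt; ring.
have /andP[b0 bpi] : 0 <= acos c <= pi by rewrite acos_ge0// acos_lepi.
have cE : cos (acos c) = c by rewrite acosK// in_itv.
have pi0 := pi_ge0 R.
have [s0|s0] := leP 0 s.
  exists (acos c); first by apply/andP; split; lra.
  by rewrite cE sE ger0_norm.
exists (- acos c); first by apply/andP; split; lra.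
by rewrite cosN sinN cE sE ltr0_norm// opprK.
Qed.

Lemma polar_angle (x y phi0 : R) : exists2 a, phi0 <= a <= phi0 + 2 * pi &
  x = Num.sqrt (x ^+ 2 + y ^+ 2) * cos a /\
  y = Num.sqrt (x ^+ 2 + y ^+ 2) * sin a.
Proof.
set N := Num.sqrt _; pose t := phi0 + pi.
have pi0 := pi_ge0 R.
have NE : N ^+ 2 = x ^+ 2 + y ^+ 2 by rewrite sqr_sqrtr// addr_ge0 ?sqr_ge0.
have [N0|N0] := eqVneq N 0.
  exists phi0; first by apply/andP; split; lra.
  move/eqP : NE; rewrite N0 expr0n/= eq_sym paddr_eq0 ?sqr_ge0//.
  by rewrite !sqrf_eq0 => /andP[/eqP-> /eqP->]; rewrite !mul0r.
have := cos2Dsin2 t => ct.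
(* Measured from the middle of the wanted interval, the angle is the principal
   determination. *)
have [|b /andP[b1 b2] [cb sb]] := @unit_vector_angle
    ((x / N) * cos t + (y / N) * sin t) ((y / N) * cos t - (x / N) * sin t).
  transitivity ((x ^+ 2 + y ^+ 2) / N ^+ 2 * (cos t ^+ 2 + sin t ^+ 2)).
    by field.
  by rewrite ct mulr1 -NE divff// sqrf_eq0.
exists (b + t); first by rewrite /t; apply/andP; split; lra.
have E (z : R) : N * (z / N) * (cos t ^+ 2 + sin t ^+ 2) = z.
  by rewrite ct; field.
rewrite (cosD b t) (sinD b t) -cb -sb.
by split; [rewrite -[LHS](E x)|rewrite -[LHS](E y)]; ring.
Qed.

(** Each term [1 / sqrt (n + 1)] is at most [2 * (sqrt (n + 1) - sqrt n)]. *)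
Lemma sum_inv_sqrt_le (N : nat) :
  \sum_(n < N) (Num.sqrt n.+1%:R)^-1 <= 2 * Num.sqrt N%:R :> R.
Proof.
elim: N => [|N IH]; first by rewrite big_ord0 sqrtr0 mulr0.
rewrite big_ord_recr /=; apply: le_trans (lerD IH (lexx _)) _.
set a := Num.sqrt N%:R; set b := Num.sqrt N.+1%:R.
have b0 : 0 < b by rewrite sqrtr_gt0.
have a0 : 0 <= a by exact: sqrtr_ge0.
have aE : a ^+ 2 = N%:R by rewrite sqr_sqrtr.
have bE : b ^+ 2 = N%:R + 1 by rewrite sqr_sqrtr// -natr1.
rewrite -lerBrDl -(ler_pM2r b0) mulVf ?gt_eqF//.
have := sqr_ge0 (a - b); nra.
Qed.

(** Turns a bound on the variation of [r ^ - (m + 1)] into a bound on the variation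
of the radius [r]: by the hypotheses
[a ^ (m + 1) - b ^ (m + 1) = (vb - va) * a ^ (m + 1) * b ^ (m + 1)], and for
[b <= a] the left-hand side is at least [a ^ m * (a - b)]. *)
Lemma radius_gap (a b va vb delta : R) (m : nat) : 0 < a -> 0 < b -> 0 <= delta ->
  a ^+ m.+1 * va = 1 -> b ^+ m.+1 * vb = 1 -> vb - va <= delta ->
  a - b <= delta * (a * b ^+ m.+1).
Proof.
move=> a0 b0 d0 aE bE dE.
have am0 : 0 < a ^+ m by exact: exprn_gt0.
have bm0 : 0 < b ^+ m by exact: exprn_gt0.
have [ab|ab] := leP a b.
  apply: (@le_trans _ _ 0); first by rewrite subr_le0.
  by rewrite mulr_ge0// mulr_ge0 ?exprn_ge0 ?ltW.
rewrite -(ler_pM2l am0).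
have -> : a ^+ m * (delta * (a * b ^+ m.+1)) = delta * (a ^+ m.+1 * b ^+ m.+1).
  by rewrite !exprS; ring.
apply: (@le_trans _ _ ((vb - va) * (a ^+ m.+1 * b ^+ m.+1))); last first.
  by rewrite ler_wpM2r// mulr_ge0// exprn_ge0// ltW.
have -> : (vb - va) * (a ^+ m.+1 * b ^+ m.+1) = a ^+ m.+1 - b ^+ m.+1.
  transitivity (a ^+ m.+1 * (b ^+ m.+1 * vb) - b ^+ m.+1 * (a ^+ m.+1 * va)); first by ring.
  by rewrite aE bE !mulr1.
rewrite !exprSr mulrBr lerD2l lerN2 ler_pM2r//.
by rewrite lerXn2r ?nnegrE ?ltW.
Qed.
End real_lemmas.

(** * Area of the neighbourhoods of a spiral *)

Section spiral.
Variable R : realType.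
Variables (j' : nat) (e phi0 kappa L q : R) (v rho : R -> R).
Let j := j'.+1.
Let m := (2 * j)%N.

(** The sign [e] covers both orientations: a trajectory that reaches the origin
backwards in time turns clockwise when it is followed towards the origin. *)
Definition spiral : set (R * R) :=
  [set (rho phi * cos phi, e * (rho phi * sin phi)) | phi in [set phi | phi0 <= phi]].

Hypotheses (e2 : e ^+ 2 = 1) (kappa0 : 0 < kappa) (L0 : 0 <= L) (q0 : 0 < q).
Hypothesis rho_gt0 : forall phi, phi0 <= phi -> 0 < rho phi.
Hypothesis rho_v : forall phi, phi0 <= phi -> rho phi ^+ m * v phi = 1.
Hypothesis v_ge : forall phi, phi0 <= phi -> q <= v phi.
Hypothesis v_turn : forall phi, phi0 <= phi -> v (phi + 2 * pi) = v phi + kappa.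
Hypothesis v_lip : forall phi psi, phi0 <= phi -> phi0 <= psi ->
  `|v phi - v psi| <= L * `|phi - psi|.

Let pi0 : 0 < pi :> R. Proof. exact: pi_gt0. Qed.

Lemma m_succ : m = m.-1.+1. Proof. by rewrite /m mul2n. Qed.

Lemma ge_phi0_turn phi n : phi0 <= phi -> phi0 <= phi + 2 * pi * n%:R.
Proof. by move=> h; apply: (le_trans h); rewrite lerDl !mulr_ge0// ltW. Qed.

Lemma v_turns phi n : phi0 <= phi -> v (phi + 2 * pi * n%:R) = v phi + kappa * n%:R.
Proof.
move=> h; elim: n => [|n IH]; first by rewrite !mulr0 !addr0.
have -> : phi + 2 * pi * n.+1%:R = phi + 2 * pi * n%:R + 2 * pi.
  by rewrite -natr1; ring.
by rewrite v_turn ?ge_phi0_turn// IH -natr1; ring.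
Qed.

Lemma cos_turns (phi : R) n : cos (phi + 2 * pi * n%:R) = cos phi.
Proof.
by have := periodicn (@cosD2pi R) n phi; rewrite -(mulr_natl pi 2) -(mulr_natr (2 * pi) n).
Qed.

Lemma sin_turns (phi : R) n : sin (phi + 2 * pi * n%:R) = sin phi.
Proof.
by have := periodicn (@sinD2pi R) n phi; rewrite -(mulr_natl pi 2) -(mulr_natr (2 * pi) n).
Qed.

Lemma rho_small (eps alpha : R) : 0 < eps -> phi0 <= alpha ->
  exists n, rho (alpha + 2 * pi * n%:R) < eps.
Proof.
move=> eps0 ha; have em0 : 0 < kappa * eps ^+ m by rewrite mulr_gt0// exprn_gt0.
pose n := (Num.truncn (kappa * eps ^+ m)^-1).+1; exists n.
rewrite ltNge; apply/negP => h.
have hn := ge_phi0_turn n ha.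
have := rho_v hn; rewrite v_turns// => E.
have : eps ^+ m * (kappa * n%:R) < 1.
  rewrite -[ltRHS]E; apply: (@lt_le_trans _ _ (eps ^+ m * (v alpha + kappa * n%:R))).
    by rewrite ltr_pM2l ?exprn_gt0// ltrDr (lt_le_trans q0)// v_ge.
  rewrite ler_wpM2r ?lerXn2r ?nnegrE ?(ltW eps0) ?(ltW (rho_gt0 hn))//.
  by rewrite ltW// addr_gt0// ?mulr_gt0 ?ltr0n// (lt_le_trans q0)// v_ge.
apply/negP; rewrite -leNgt mulrA (mulrC _ kappa) -ler_pdivrMl// mulr1.
by apply: ltW; rewrite /n; exact: truncnS_gt.
Qed.

(** Along the direction [alpha] the values of [rho ^ -m] form an arithmetic
progression of step [kappa] starting below [a ^ -m]; its first term beyond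
[a ^ -m] exceeds it by at most [kappa], and [radius_gap] concludes. *)
Lemma turn_near_radius (alpha a eps vmax : R) : phi0 <= alpha -> v alpha <= vmax ->
  0 < a -> a ^+ m * vmax <= 1 -> kappa * a ^+ m.+1 < eps ->
  exists n, `|rho (alpha + 2 * pi * n%:R) - a| < eps.
Proof.
move=> ha vmaxP a0 avmax aeps.
have am0 : 0 < a ^+ m by exact: exprn_gt0.
pose P n := (a ^+ m)^-1 < v alpha + kappa * n%:R.
have exP : exists n, P n.
  exists (Num.truncn ((a ^+ m)^-1 / kappa)).+1; rewrite /P.
  apply: (@lt_trans _ _ (kappa * (Num.truncn ((a ^+ m)^-1 / kappa)).+1%:R)).
    by rewrite -ltr_pdivrMl// mulrC; exact: truncnS_gt.
  by rewrite ltrDr (lt_le_trans q0)// v_ge.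
case: (ex_minnP exP) => n Pn nmin.
have n0 : (0 < n)%N.
  rewrite lt0n; apply/eqP => nE; move: Pn; rewrite /P nE mulr0 addr0.
  apply/negP; rewrite -leNgt; apply: (le_trans vmaxP).
  by rewrite -[leRHS]mulr1 ler_pdivlMl.
have Pn1 : v alpha + kappa * n.-1%:R <= (a ^+ m)^-1.
  by rewrite leNgt; apply/negP => /nmin; rewrite -ltnS prednK// ltnn.
exists n; set b := rho _.
have hn := ge_phi0_turn n ha.
have b0 : 0 < b by exact: rho_gt0.
have bE : b ^+ m * (v alpha + kappa * n%:R) = 1 by rewrite -v_turns// rho_v.
have ba : b < a.
  rewrite ltNge; apply/negP => ab; move: Pn; rewrite /P; apply/negP; rewrite -leNgt.
  rewrite -[leRHS]mulr1 ler_pdivlMl// -[leRHS]bE.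
  apply: ler_wpM2r; last by rewrite lerXn2r ?nnegrE ?(ltW a0) ?(ltW b0).
  by rewrite addr_ge0 ?mulr_ge0 ?(ltW kappa0)// (le_trans (ltW q0))// v_ge.
rewrite distrC ger0_norm ?subr_ge0 ?(ltW ba)//; apply: le_lt_trans aeps.
have gap : v alpha + kappa * n%:R - (a ^+ m)^-1 <= kappa.
  have nE : n%:R = n.-1%:R + 1 :> R by rewrite natr1 prednK.
  by rewrite nE; lra.
have aE : a ^+ m * (a ^+ m)^-1 = 1 by rewrite divff// gt_eqF.
move: gap bE aE; set va := (a ^+ m)^-1; rewrite m_succ => gap bE aE.
apply: (le_trans (radius_gap a0 b0 (ltW kappa0) aE bE gap)).
rewrite ler_pM2l// (exprS a) ler_pM2l//.
by rewrite lerXn2r ?nnegrE ?ltW.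
Qed.

(** For a point other than the origin, [turn_near_radius] is applied in its own
direction: the factor [1 + kappa] in [c] makes [kappa * a ^ (m + 1)] smaller than
[r ^ (m + 1)], and [r0] keeps the point inside the first turn. *)
Lemma nbhd_contains_square : exists c r0 : R, [/\ 0 < c, 0 < r0 &
  forall r : R, 0 < r <= r0 -> square (0, 0) (c * r) `<=` nbhd spiral (r ^+ m.+1)].
Proof.
pose vmax := v phi0 + L * (2 * pi).
have vmax0 : 0 <= vmax.
  by rewrite addr_ge0 ?mulr_ge0// ?(ltW pi0)//; apply: le_trans (v_ge (lexx _)); exact: ltW.
have k0 := kappa0; have x0 : 0 < 1 + kappa by lra.
exists (2 * (1 + kappa))^-1, (1 + vmax)^-1; split;
  [by rewrite invr_gt0 mulr_gt0|by rewrite invr_gt0; lra|].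
move=> r /andP[r0 rle] p /squareP[/=]; rewrite !subr0 => px py.
set a := enorm p.
have a0 : 0 <= a by exact: enorm_ge0.
have al : a <= r / (1 + kappa).
  apply: (le_trans (enorm_le_sum p)); apply: (le_trans (lerD px py)).
  by rewrite le_eqVlt; apply/orP; left; apply/eqP; field; rewrite gt_eqF.
have r1 : r <= 1 by apply: (le_trans rle); rewrite invf_le1 ?lerDl//; lra.
have [alpha /andP[al1 al2] [xE yE]] := polar_angle p.1 (e * p.2) phi0.
have aE : Num.sqrt (p.1 ^+ 2 + (e * p.2) ^+ 2) = a by rewrite exprMn e2 mul1r.
rewrite {}aE in xE yE.
have eps0 : 0 < r ^+ m.+1 by exact: exprn_gt0.
suff [n hn] : exists n, `|rho (alpha + 2 * pi * n%:R) - a| < r ^+ m.+1.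
  apply/nbhdP; exists (rho (alpha + 2 * pi * n%:R) * cos alpha,
      e * (rho (alpha + 2 * pi * n%:R) * sin alpha)).
    by exists (alpha + 2 * pi * n%:R); [exact: ge_phi0_turn|rewrite cos_turns sin_turns].
  have -> : enorm (p - (rho (alpha + 2 * pi * n%:R) * cos alpha,
      e * (rho (alpha + 2 * pi * n%:R) * sin alpha))) =
      `|rho (alpha + 2 * pi * n%:R) - a|; last exact: hn.
    set b := rho _; rewrite -sqrtr_sqr /enorm /=; congr Num.sqrt.
    have y2 : p.2 = e * (a * sin alpha) by rewrite -yE mulrA -expr2 e2 mul1r.
    rewrite {1}xE y2.
    transitivity ((b - a) ^+ 2 * (cos alpha ^+ 2 + e ^+ 2 * sin alpha ^+ 2)); first by ring.
    by rewrite e2 mul1r cos2Dsin2 mulr1.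
have [a_eq0|a_neq0] := eqVneq a 0.
  have [n hn] := rho_small eps0 al1; exists n.
  by rewrite a_eq0 subr0 gtr0_norm// rho_gt0// ge_phi0_turn.
have {a_neq0}a_gt0 : 0 < a by rewrite lt_neqAle eq_sym a_neq0.
have vl : v alpha <= vmax.
  have := v_lip al1 (lexx phi0); rewrite ler_distl => /andP[_]; move/le_trans; apply.
  by rewrite lerD2l ler_wpM2l// ger0_norm ?subr_ge0// lerBlDl.
have ar : a <= r by apply: (le_trans al); rewrite ler_pdivrMr// ler_peMr ?(ltW r0)//; lra.
apply: (turn_near_radius al1 vl a_gt0).
  apply: (@le_trans _ _ ((1 + vmax)^-1 * vmax)); last first.
    by rewrite mulrC ler_pdivrMr; lra.
  rewrite ler_wpM2r//; apply: le_trans rle; apply: le_trans ar.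
  by rewrite m_succ exprS ler_piMr// exprn_ile1// (le_trans _ r1)//
    (le_trans al)// ler_pdivrMr// ler_peMr ?(ltW r0)//; lra.
apply: (@le_lt_trans _ _ (kappa * (r ^+ m * (r / (1 + kappa))))).
  rewrite exprSr ler_pM2l// ler_pM ?exprn_ge0// lerXn2r ?nnegrE ?(ltW r0)//.
rewrite exprSr mulrCA ltr_pM2l ?exprn_gt0// mulrCA -[ltRHS]mulr1 ltr_pM2l//.
by rewrite ltr_pdivrMr// mul1r; lra.
Qed.

(** A sector in which the radius is at most [b] contributes a piece of diameter
at most a constant times [b] times its angle, as an arc of circle would: the
Lipschitz bound on [v] makes the radius vary by at most [L / q * b] per unit of
angle. *)
Lemma sector_dist (phi psi b : R) : phi0 <= phi -> phi0 <= psi ->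
  rho phi <= b -> rho psi <= b ->
  `|rho phi * cos phi - rho psi * cos psi| <= (L / q + 1) * b * `|phi - psi| /\
  `|e * (rho phi * sin phi) - e * (rho psi * sin psi)|
    <= (L / q + 1) * b * `|phi - psi|.
Proof.
move=> hphi hpsi bphi bpsi; set d := `|phi - psi|.
have d0 : 0 <= d by exact: normr_ge0.
have gap x y : phi0 <= x -> phi0 <= y -> rho x <= b -> `|x - y| = d ->
    rho x - rho y <= L / q * b * d.
  move=> hx hy xb xyd; have x0 := rho_gt0 hx; have y0 := rho_gt0 hy.
  have Ld : 0 <= L * d by rewrite mulr_ge0.
  have vd : v y - v x <= L * d.
    by rewrite -xyd distrC; apply: le_trans (v_lip hy hx); exact: ler_norm.
  have := rho_v hx; have yE := rho_v hy.
  move: (yE); rewrite m_succ => yE' xE'.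
  apply: (le_trans (radius_gap x0 y0 Ld xE' yE' vd)); rewrite -m_succ.
  rewrite (_ : L / q * b * d = L * d * (b * q^-1)); last by ring.
  rewrite ler_wpM2l// ler_pM ?(ltW x0) ?exprn_ge0 ?(ltW y0)//.
  rewrite -[leRHS]mulr1 ler_pdivlMl// -[leRHS]yE mulrC.
  by rewrite ler_wpM2l ?v_ge// exprn_ge0// ltW.
have rd : `|rho phi - rho psi| <= L / q * b * d.
  by rewrite ler_norml lerNl opprB !gap// distrC.
have en : `|e| = 1.
  by apply/eqP; rewrite -sqr_norm_eq1 e2.
have y0 := rho_gt0 hpsi.
have tr (f : R -> R) : `|f phi| <= 1 -> `|f phi - f psi| <= d ->
    `|rho phi * f phi - rho psi * f psi| <= (L / q + 1) * b * d.
  move=> f1 fd.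
  rewrite (_ : _ - _ = (rho phi - rho psi) * f phi + rho psi * (f phi - f psi)); last by ring.
  apply: (le_trans (ler_normD _ _)); rewrite !normrM (gtr0_norm y0).
  rewrite !mulrDl mul1r; apply: lerD.
    by rewrite -[leRHS]mulr1; apply: ler_pM.
  by apply: ler_pM => //; exact: ltW.
split; first by apply: tr; [rewrite ler_norml cos_geN1 cos_le1|exact: lipschitz_cos].
rewrite -mulrBr normrM en mul1r.
by apply: tr; [rewrite ler_norml sin_geN1 sin_le1|exact: lipschitz_sin].
Qed.

Lemma v_turn_ge (q1 phi : R) n : q1 <= q -> q1 <= kappa ->
  phi0 + 2 * pi * n%:R <= phi -> q1 * n.+1%:R <= v phi.
Proof.
move=> qq qk h; rewrite -(subrK (2 * pi * n%:R) phi) v_turns; last first.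
  by rewrite lerBrDr.
rewrite -natr1 mulrDr mulr1 addrC lerD//; last by rewrite ler_wpM2r.
by apply: (le_trans qq); apply: v_ge; rewrite lerBrDr.
Qed.

Lemma turn_decomposition (phi : R) : phi0 <= phi ->
  exists n, phi0 + 2 * pi * n%:R <= phi < phi0 + 2 * pi * n.+1%:R.
Proof.
move=> h; have p20 : 0 < 2 * pi :> R by rewrite mulr_gt0.
have x0 : 0 <= (phi - phi0) / (2 * pi) by rewrite divr_ge0 ?subr_ge0// ltW.
exists (Num.truncn ((phi - phi0) / (2 * pi))).
have /andP[l1 l2] := truncn_itv x0.
rewrite -lerBrDl -ltrBlDl.
by rewrite mulrC -ler_pdivlMr// l1 /= mulrC -ltr_pdivrMr.
Qed.

Section cover.
Variables (q1 r : R).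
Hypotheses (q10 : 0 < q1) (q1q : q1 <= q) (q1k : q1 <= kappa) (r01 : 0 < r <= 1).
Let eps := r ^+ m.+1.
(* [N] separates the turns covered by small squares from those that lie in the
   central square, [B n] is the order of the radius of turn [n], and [M n] is the
   number of sectors into which turn [n] is cut. *)
Let N := (Num.truncn (r ^+ m)^-1).+1.
Let K := 2 + q1^-1.
Let B (n : nat) := (r ^+ j' * Num.sqrt n.+1%:R)^-1.
Let M (n : nat) := (Num.truncn (B n / eps)).+1.
Let H := (L / q + 1) * K * (2 * pi).

Let r0 : 0 < r. Proof. by case/andP: r01. Qed.
Let r1 : r <= 1. Proof. by case/andP: r01. Qed.
Let eps0 : 0 < eps. Proof. exact: exprn_gt0. Qed.
Let rm0 : 0 < r ^+ m. Proof. exact: exprn_gt0. Qed.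
Let B0 n : 0 < B n. Proof. by rewrite invr_gt0 mulr_gt0 ?exprn_gt0 ?sqrtr_gt0. Qed.
Let K2 : 2 <= K. Proof. by rewrite lerDl invr_ge0 ltW. Qed.

Lemma N_bounds : (r ^+ m)^-1 < N%:R /\ N%:R <= 2 * (r ^+ m)^-1.
Proof.
split; first exact: truncnS_gt.
have x0 : 0 <= (r ^+ m)^-1 by rewrite invr_ge0 ltW.
have /andP[l1 _] := truncn_itv x0.
rewrite /N -natr1.
have : 1 <= (r ^+ m)^-1 by rewrite invf_ge1// exprn_ile1// ltW.
lra.
Qed.

Lemma M_bounds n : B n <= eps * (M n)%:R /\ eps * (M n)%:R <= B n + eps.
Proof.
have x0 : 0 <= B n / eps by rewrite divr_ge0// ltW.
have /andP[l1 l2] := truncn_itv x0.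
split; first by rewrite mulrC -ler_pdivrMr// ltW.
by rewrite mulrC -ler_pdivlMr// mulrDl divff ?gt_eqF// /M -natr1 lerD2r.
Qed.

Lemma radius_of_late_turn n phi : (N <= n)%N -> phi0 + 2 * pi * n%:R <= phi ->
  rho phi <= K * r.
Proof.
move=> Nn h; have hp : phi0 <= phi.
  by apply: le_trans h; rewrite lerDl !mulr_ge0// ltW.
have x0 := rho_gt0 hp; rewrite -ler_pdivrMr// leNgt; apply/negP => Kx.
have := v_turn_ge q1q q1k h; have := rho_v hp; set x := rho phi in x0 Kx * => xE vn.
have [N1 _] := N_bounds.
have y0 : 0 < x / r by rewrite divr_gt0.
have q1y : q1 * (x / r) <= 1.
  apply: (@le_trans _ _ (q1 * (x / r) ^+ m)).
    rewrite ler_pM2l// m_succ exprS ler_peMr ?(ltW y0)// exprn_ege1//.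
    by apply: ltW; apply: lt_trans Kx; apply: lt_le_trans K2; lra.
  rewrite -[leRHS]xE expr_div_n mulrCA ler_pM2l ?exprn_gt0//.
  apply: le_trans vn; rewrite ler_pM2l//; apply: ltW; apply: (lt_le_trans N1).
  by rewrite ler_nat ltnW.
move: q1y; apply/negP; rewrite -ltNge -[ltLHS](mulfV (lt0r_neq0 q10)) ltr_pM2l//.
by apply: lt_trans Kx; rewrite /K ltrDr.
Qed.

(** Squaring leaves [rho ^ 2 * r ^ (m - 2) * (n + 1) <= K ^ 2] to prove.  Since
[m >= 2], the product [rho ^ 2 * r ^ (m - 2)] is at most the larger of [rho ^ m]
and [r ^ m], and [n + 1] times either of them is bounded.  Comparing with
[1 / sqrt (n + 1)] rather than with the exact order [(n + 1) ^ (- 1 / m)] keeps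
all the exponents of [r] integral. *)
Lemma radius_of_early_turn n phi : (n < N)%N -> phi0 + 2 * pi * n%:R <= phi ->
  rho phi <= K * B n.
Proof.
move=> nN h; have hp : phi0 <= phi.
  by apply: le_trans h; rewrite lerDl !mulr_ge0// ltW.
have x0 := rho_gt0 hp.
have := v_turn_ge q1q q1k h; have := rho_v hp; set x := rho phi in x0 * => xE vn.
have s0 : 0 < Num.sqrt n.+1%:R :> R by rewrite sqrtr_gt0.
have rj0 : 0 < r ^+ j' by exact: exprn_gt0.
rewrite /B ler_pdivlMr ?mulr_gt0//.
rewrite -(ler_pXn2r (n := 2))// ?nnegrE ?mulr_ge0 ?(ltW x0) ?(ltW rj0) ?(ltW s0)//;
  last by rewrite (le_trans _ K2).
rewrite !exprMn sqr_sqrtr//.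
have [N1 N2] := N_bounds.
have nq : x ^+ m * n.+1%:R <= q1^-1.
  rewrite -[leRHS]mulr1 ler_pdivlMl// -[leRHS]xE mulrCA ler_pM2l//.
  exact: exprn_gt0.
have nr : r ^+ m * n.+1%:R <= 2.
  rewrite mulrC -ler_pdivlMr//; apply: le_trans N2.
  by rewrite ler_nat.
have mE (y : R) : y ^+ m = y ^+ 2 * (y ^+ j') ^+ 2.
  by rewrite -exprM -exprD /m /j mulnS (mulnC j').
have X : x ^+ 2 * (r ^+ j') ^+ 2 <= x ^+ m + r ^+ m.
  have [rx|/ltW xr] := leP r x.
    rewrite ler_wpDr ?(ltW rm0)// mE ler_wpM2l ?sqr_ge0//.
    by rewrite lerXn2r ?nnegrE ?exprn_ge0 ?(ltW r0) ?(ltW x0)// lerXn2r ?nnegrE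
      ?(ltW r0) ?(ltW x0).
  rewrite ler_wpDl ?exprn_ge0 ?(ltW x0)// (mE r) ler_wpM2r ?sqr_ge0//.
  by rewrite lerXn2r ?nnegrE ?(ltW r0) ?(ltW x0).
rewrite mulrA; apply: (@le_trans _ _ ((x ^+ m + r ^+ m) * n.+1%:R)).
  by rewrite ler_wpM2r.
rewrite mulrDl; apply: (le_trans (lerD nq nr)).
have : 0 < q1^-1 by rewrite invr_gt0.
rewrite /K; nra.
Qed.

Let center n i : R * R :=
  let phi := phi0 + 2 * pi * n%:R + 2 * pi / (M n)%:R * i%:R in
  (rho phi * cos phi, e * (rho phi * sin phi)).

Lemma spiral_cover p : spiral p -> square (0, 0) (K * r) p \/
  exists n i, [/\ (n < N)%N, (i < M n)%N & square (center n i) (H * eps) p].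
Proof.
move=> [phi /= hp <-].
have [n /andP[n1 n2]] := turn_decomposition hp.
have [Nn|nN] := leqP N n.
  left; have x0 := rho_gt0 hp; have xK := radius_of_late_turn Nn n1.
  have en : `|e| = 1.
    by apply/eqP; rewrite -sqr_norm_eq1 e2.
  apply/squareP; rewrite /= !subr0 !normrM en mul1r (gtr0_norm x0).
  split; apply: le_trans xK; rewrite ler_piMr ?(ltW x0)// ler_norml.
    by rewrite cos_geN1 cos_le1.
  by rewrite sin_geN1 sin_le1.
right; pose d : R := 2 * pi / (M n)%:R.
have M0 : 0 < (M n)%:R :> R by rewrite ltr0n.
have d0 : 0 < d by rewrite divr_gt0// mulr_gt0.
pose t := phi - (phi0 + 2 * pi * n%:R).
have t0 : 0 <= t by rewrite subr_ge0.
have td : 0 <= t / d by rewrite divr_ge0// ltW.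
have /andP[i1 i2] := truncn_itv td; set i := Num.truncn _ in i1 i2.
exists n, i; split=> //.
  rewrite -(ltr_nat R); apply: (le_lt_trans i1).
  rewrite ltr_pdivrMr// /d mulrC divfK ?gt_eqF// /t ltrBlDl.
  by move: n2; rewrite -(natr1 n) mulrDr mulr1 addrA.
rewrite /center; set psi := _ + 2 * pi / _ * _.
have psi_ge : phi0 + 2 * pi * n%:R <= psi by rewrite lerDl mulr_ge0// ltW.
have psi0 : phi0 <= psi.
  by apply: le_trans psi_ge; rewrite lerDl !mulr_ge0// ltW.
have psi_le : `|phi - psi| <= d.
  move: i1 i2; rewrite ler_pdivlMr// ltr_pdivrMr// -natr1 => i1 i2.
  have E : phi - psi = t - i%:R * d by rewrite /t /psi /d; ring.
  by rewrite E ger0_norm ?subr_ge0// lerBlDl; lra.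
have := sector_dist hp psi0 (radius_of_early_turn nN n1) (radius_of_early_turn nN psi_ge).
have bd : (L / q + 1) * (K * B n) * `|phi - psi| <= H * eps.
  have c0 : 0 <= L / q + 1 by rewrite addr_ge0// divr_ge0// ltW.
  apply: (@le_trans _ _ ((L / q + 1) * (K * B n) * d)).
    by rewrite ler_wpM2l// !mulr_ge0// ?(ltW (B0 n))// (le_trans _ K2).
  rewrite /H /d mulrA ler_pdivrMr//.
  have [MB _] := M_bounds n.
  rewrite (_ : _ * (2 * pi) = (L / q + 1) * K * (2 * pi) * B n); last by ring.
  rewrite -[leRHS]mulrA ler_wpM2l// !mulr_ge0 ?(ltW pi0)// (le_trans _ K2)//.
by move=> [h1 h2]; apply/squareP; split; [apply: le_trans h1 bd|apply: le_trans h2 bd].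
Qed.

Lemma area_nbhd_spiral_le :
  (area (nbhd spiral eps) <= ((4 * (K + 1) ^+ 2 + 24 * (H + 1) ^+ 2) * r ^+ 2)%:E)%E.
Proof.
have H0 : 0 <= H.
  rewrite /H !mulr_ge0 ?(ltW pi0)//; first by rewrite addr_ge0// divr_ge0// ltW.
  by rewrite (le_trans _ K2).
have K0 : 0 <= K by rewrite (le_trans _ K2).
have epsr : eps <= r by rewrite /eps exprS ler_piMr ?(ltW r0)// exprn_ile1// ltW.
apply: (le_trans (@area_le_cover _ _ (0, 0) (K * r + eps) (H * eps + eps) N M center
  _ _ _ _)).
- by apply: addr_ge0; [apply: mulr_ge0 => //; exact: ltW|exact: ltW].
- by apply: addr_ge0; [apply: mulr_ge0 => //; exact: ltW|exact: ltW].
- exact: measurable_nbhd.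
- move=> p /nbhdP[a /spiral_cover ac pa].
  have d1 : `|p.1 - a.1| <= eps.
    by apply: le_trans (ltW pa); exact: (normr_fst_le_enorm (p - a)).
  have d2 : `|p.2 - a.2| <= eps.
    by apply: le_trans (ltW pa); exact: (normr_snd_le_enorm (p - a)).
  have enlarge c h : square c h a -> square c (h + eps) p.
    move=> /squareP[s1 s2]; apply/squareP; split.
      rewrite -(subrKA a.1) addrC; exact: le_trans (ler_normD _ _) (lerD _ _).
    rewrite -(subrKA a.2) addrC; exact: le_trans (ler_normD _ _) (lerD _ _).
  case: ac => [/enlarge|[n [i [nN iM /enlarge]]]]; first by left.
  by right; exists n, i.
rewrite lee_fin [leRHS]mulrDl lerD//.
  rewrite !exprMn -mulrA (_ : 2 ^+ 2 = 4); last by rewrite -natrX.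
  rewrite ler_pM2l// -exprMn; apply: lerXn2r; rewrite ?nnegrE.
  - by apply: addr_ge0; [apply: mulr_ge0 => //; exact: ltW|exact: ltW].
  - by apply: mulr_ge0; [exact: addr_ge0|exact: ltW].
  - by rewrite (mulrDl K) mul1r lerD2l.
rewrite -mulr_suml.
have [N1 N2] := N_bounds.
have sumB : \sum_(n < N) B n <= 4 * (r ^+ (j' + j))^-1.
  rewrite (eq_bigr (fun n : 'I_N => (r ^+ j')^-1 * (Num.sqrt n.+1%:R)^-1)); last first.
    by move=> n _; rewrite /B invfM.
  rewrite -mulr_sumr exprD invfM mulrCA ler_pM2l ?invr_gt0 ?exprn_gt0//.
  apply: (le_trans (sum_inv_sqrt_le _ _)).
  rewrite (_ : 4 = 2 * 2); last by rewrite -natrM.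
  rewrite -mulrA ler_pM2l// -(ler_pXn2r (n := 2))// ?nnegrE ?sqrtr_ge0//; last first.
    by rewrite mulr_ge0// invr_ge0 exprn_ge0// ltW.
  rewrite sqr_sqrtr// exprMn exprVn -exprM mulnC -/m.
  apply: (le_trans N2); rewrite ler_pM2r ?invr_gt0// -natrX ler_nat//.
have sumM : eps * \sum_(n < N) (M n)%:R <= 4 * (r ^+ (j' + j))^-1 + N%:R * eps.
  rewrite mulr_sumr.
  apply: (@le_trans _ _ (\sum_(n < N) (B n + eps))).
    by apply: ler_sum => n _; have [] := M_bounds n.
  by rewrite big_split/= lerD// sumr_const card_ord mulr_natl.
rewrite (_ : _ * _ = (eps * \sum_(n < N) (M n)%:R) * eps * (4 * (H + 1) ^+ 2)); last by ring.
rewrite (_ : 24 * _ * _ = 6 * r ^+ 2 * (4 * (H + 1) ^+ 2)); last by ring.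
apply: ler_wpM2r; first by apply: mulr_ge0 => //; exact: sqr_ge0.
apply: (@le_trans _ _ ((4 * (r ^+ (j' + j))^-1 + N%:R * eps) * eps)).
  by rewrite ler_wpM2r// ltW.
have e1 : (r ^+ (j' + j))^-1 * eps = r ^+ 2.
  have mE : m.+1 = (j' + j + 2)%N.
    by rewrite /m /j mul2n -addnn !(addnS, addSn) addn0.
  by rewrite /eps mE (exprD _ (j' + j)) mulKf// gt_eqF// exprn_gt0.
have e3 : (r ^+ m)^-1 * eps * eps <= r ^+ 2.
  rewrite /eps exprSr mulKf ?gt_eqF// (mulrC (r ^+ m)) mulrA -expr2.
  by rewrite ler_piMr ?sqr_ge0// exprn_ile1// ltW.
have e2' : N%:R * eps * eps <= 2 * ((r ^+ m)^-1 * eps * eps).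
  rewrite -mulrA (_ : 2 * _ = 2 * (r ^+ m)^-1 * (eps * eps)); last by ring.
  by apply: ler_wpM2r => //; apply: mulr_ge0; exact: ltW.
rewrite mulrDl -mulrA e1; lra.
Qed.
End cover.

Lemma spiral_box_dim :
  has_box_dim spiral (2 - 2 / m.+1%:R) /\ minkowski_nondegenerate spiral.
Proof.
have [c [r0 [c0 r00 inside]]] := nbhd_contains_square.
pose rm := Num.min r0 1.
have rm0 : 0 < rm by rewrite lt_min r00 ltr01.
pose q1 := Num.min q kappa.
have q10 : 0 < q1 by rewrite lt_min q0 kappa0.
have [q1q q1k] : q1 <= q /\ q1 <= kappa by rewrite !ge_min !lexx orbT.
pose C := 4 * (2 + q1^-1 + 1) ^+ 2 +
  24 * ((L / q + 1) * (2 + q1^-1) * (2 * pi) + 1) ^+ 2 : R.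
have C0 : 0 < C.
  apply: ltr_wpDr; first by apply: mulr_ge0 => //; exact: sqr_ge0.
  by apply: mulr_gt0 => //; rewrite exprn_gt0// !addr_gt0// invr_gt0.
apply: (@box_dim_of_area_bounds _ _ _ (4 * c ^+ 2) C (rm ^+ m.+1)) => //.
- exact: exprn_gt0.
- by rewrite mulr_gt0// exprn_gt0.
- by rewrite subr_ge0 ler_pdivrMr ?ltr0n// ler_peMr// ler1n.
move=> eps /andP[eps0 epsm].
pose r := eps `^ (m.+1%:R^-1).
have r_gt0 : 0 < r by exact: powR_gt0.
have rE : r ^+ m.+1 = eps.
  by rewrite -powR_mulrn ?(ltW r_gt0)// /r -powRrM mulVf ?pnatr_eq0// powRr1// ltW.
have r2E : eps `^ (2 - (2 - 2 / m.+1%:R)) = r ^+ 2.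
  by rewrite opprB addrC subrK -powR_mulrn ?(ltW r_gt0)// /r -powRrM mulrC.
have : r <= rm.
  rewrite leNgt; apply/negP => rmr; move: epsm; rewrite -rE; apply/negP; rewrite -leNgt.
  by rewrite lerXn2r ?nnegrE ?(ltW r_gt0) ?(ltW rm0) ?(ltW rmr).
rewrite le_min => /andP[rr0 r1].
rewrite r2E -rE; apply/andP; split.
  apply: (le_trans _ (area_ge_square (p := (0, 0)) (h := c * r) _ _ _)).
  - by rewrite lee_fin !exprMn mulrA (_ : 2 ^+ 2 = 4)// -natrX.
  - by apply: mulr_ge0; exact: ltW.
  - exact: measurable_nbhd.
  - by apply: inside; rewrite r_gt0.
by apply: area_nbhd_spiral_le => //; rewrite r_gt0.
Qed.
End spiral.

(** * The flow in polar coordinates *)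

Section antiderivative.
Variable R : realType.

(** The base point [a] only serves to start the integral; a half-line suffices, as
the angle of a half-trajectory stays on one side of its initial value. *)
Lemma continuous_antiderivative (f : R -> R) (a : R) : continuous f ->
  exists G : R -> R, forall x, a < x -> is_derive x 1 G (f x).
Proof.
move=> cf; exists (fun x => \int[lebesgue_measure]_(t in `[a, x]) f t)%R => x ax.
have xu : x < x + 1 by rewrite ltrDl.
have [|dF FE] := continuous_FTC1_closed xu _ ax (cf x).
  apply: continuous_compact_integrable; first exact: segment_compact.
  by apply: continuous_subspaceT.
by apply: DeriveDef; [exact: dF|rewrite -derive1E].
Qed.
End antiderivative.

Section polar.
Variable R : realType.

(** The angle is only supposed continuous; near [t] it equals its value at [t] plus
the arctangent of a rational function of the coordinates, namely the tangent of
the angle between the positions at times [t] and [u]. *)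
Lemma is_derive_angle (x y r psi : R -> R) (t dx dy : R) :
  is_derive t 1 x dx -> is_derive t 1 y dy -> {for t, continuous psi} ->
  (\forall u \near t, 0 < r u) ->
  (\forall u \near t, x u = r u * cos (psi u)) ->
  (\forall u \near t, y u = r u * sin (psi u)) ->
  is_derive t 1 psi ((x t * dy - y t * dx) / (x t ^+ 2 + y t ^+ 2)).
Proof.
move=> Dx Dy cpsi r0 xE yE.
pose den u := x u * x t + y u * y t.
pose num u := y u * x t - x u * y t.
have rt := nbhs_singleton r0; have xt := nbhs_singleton xE; have yt := nbhs_singleton yE.
have wE : x t ^+ 2 + y t ^+ 2 = r t ^+ 2.
  by rewrite xt yt !exprMn -mulrDr cos2Dsin2 mulr1.
have w0 : den t != 0 by rewrite /den -!expr2 wE sqrf_eq0 gt_eqF.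
have num0 : num t = 0 by rewrite /num mulrC subrr.
have Dden : is_derive t 1 den (dx * x t + dy * y t).
  by apply: is_derive_eq; rewrite /GRing.scale/=; ring.
have Dnum : is_derive t 1 num (dy * x t - dx * y t).
  by apply: is_derive_eq; rewrite /GRing.scale/=; ring.
have Dinv := is_deriveV w0 Dden.
have Dq : is_derive t 1 (fun u => num u * (den u)^-1) ((dy * x t - dx * y t) / den t).
  apply: is_derive_eq.
  rewrite num0 /GRing.scale/=; ring.
pose h u := atan (num u / den u) + psi t.
have Dh : is_derive t 1 h ((x t * dy - y t * dx) / (x t ^+ 2 + y t ^+ 2)).
  have Da : is_derive t 1 (atan \o (fun u => num u / den u))
      ((1 + (num t / den t) ^+ 2)^-1 * ((dy * x t - dx * y t) / den t)).
    exact: is_derive1_comp.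
  apply: is_derive_eq; rewrite num0 mul0r expr0n/= !addr0 invr1 mul1r.
  by rewrite /den !expr2; congr (_ / _); ring.
apply: near_eq_is_derive Dh.
have pi2 : 0 < pi / 2 :> R by rewrite divr_gt0 ?pi_gt0.
have /cvgrPdist_lt /(_ _ pi2) cl := cpsi.
near=> u.
have ru : 0 < r u by near: u.
have xu : x u = r u * cos (psi u) by near: u.
have yu : y u = r u * sin (psi u) by near: u.
have du : `|psi t - psi u| < pi / 2 by near: u.
pose d := psi u - psi t.
have numE : num u = r u * r t * sin d.
  by rewrite /num xu yu xt yt /d sinB; ring.
have denE : den u = r u * r t * cos d.
  by rewrite /den xu yu xt yt /d cosB; ring.
rewrite /h numE denE -mulf_div divff ?mul1r ?mulf_neq0 ?gt_eqF// -/(tan d) tanK.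
  by rewrite /d subrK.
by rewrite in_itv/=; move: du; rewrite distrC ltr_norml.
Unshelve. all: by end_near. Qed.

End polar.

Lemma is_derive_continuous (R : realType) (h : R -> R) (t d : R) :
  is_derive t 1 h d -> h u @[u --> t] --> h t.
Proof. by move=> [Dh _]; exact/differentiable_continuous/derivable1_diffP. Qed.

(** In this section [t] is the time elapsed since the start of the
half-trajectory, [w] is the squared radius, and [f] is the restriction of the
homogeneous polynomial to the unit circle. *)
Section polar_flow.
Variable R : realType.
Variables (j' k : nat) (e W Fm : R) (x y psi f : R -> R).
Let j := j'.+1.
Let m := (2 * j)%N.
Let w (t : R) := x t ^+ 2 + y t ^+ 2.
Let q (t : R) := w t ^+ (j + k) * f (psi t).

Hypothesis e2 : e ^+ 2 = 1.
Hypothesis Dx : forall t : R, 0 <= t -> is_derive t 1 x (- y t * w t ^+ k + x t * q t).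
Hypothesis Dy : forall t : R, 0 <= t -> is_derive t 1 y (x t * w t ^+ k + y t * q t).
Hypothesis w_gt0 : forall t : R, 0 <= t -> 0 < w t.
Hypothesis psi_cont : {within `[0, +oo[, continuous psi}.
Hypothesis xE : forall t : R, 0 <= t -> x t = Num.sqrt (w t) * cos (psi t).
Hypothesis yE : forall t : R, 0 <= t -> y t = Num.sqrt (w t) * sin (psi t).
Hypothesis f_cont : continuous f.
Hypothesis f_bound : forall phi : R, `|f phi| <= Fm.
Hypothesis f_periodic : forall phi : R, f (phi + 2 * pi) = f phi.
Hypothesis w_bound : forall t : R, 0 <= t -> w t <= W.
Hypothesis w_small : forall d : R, 0 < d -> exists2 t : R, 0 <= t & w t < d.
Hypothesis psi_unbounded : forall B : R, exists2 t : R, 0 <= t & B < `|psi t|.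

Lemma near_gt0 (t : R) : 0 < t -> \forall u \near t, 0 <= u.
Proof.
by move=> t0; near=> u; apply: ltW; near: u; exact: lt_nbhsr.
Unshelve. all: by end_near. Qed.

Lemma psi_cont_segment (a b : R) : 0 <= a -> {within `[a, b], continuous psi}.
Proof.
move=> a0; apply: continuous_subspaceW psi_cont => u /=.
by rewrite !in_itv/= andbT => /andP[au _]; exact: le_trans au.
Qed.

Lemma psi_cont_at (t : R) : 0 < t -> {for t, continuous psi}.
Proof.
move=> t0; apply: (@within_continuous_continuous _ _ _ 0 (t + 1)).
- by rewrite addr_gt0.
- exact: psi_cont_segment.
- by rewrite in_itv/= t0 ltrDl ltr01.
Qed.

Lemma is_derive_psi (t : R) : 0 < t -> is_derive t 1 psi (w t ^+ k).
Proof.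
move=> t0; have t0' := ltW t0.
have -> : w t ^+ k = (x t * (x t * w t ^+ k + y t * q t) -
    y t * (- y t * w t ^+ k + x t * q t)) / (x t ^+ 2 + y t ^+ 2).
  rewrite (_ : _ - _ = w t ^+ k * w t); last by set A := w t ^+ k; rewrite /w; ring.
  by rewrite mulfK// gt_eqF// w_gt0.
apply: (@is_derive_angle _ _ _ (fun u => Num.sqrt (w u))) => //.
- exact: Dx.
- exact: Dy.
- exact: psi_cont_at.
- by apply: filterS (near_gt0 t0) => u u0; rewrite sqrtr_gt0 w_gt0.
- by apply: filterS (near_gt0 t0) => u; exact: xE.
- by apply: filterS (near_gt0 t0) => u; exact: yE.
Qed.

Lemma psi_nondecreasing (a b : R) : 0 <= a -> a <= b -> psi a <= psi b.
Proof.
move=> a0 ab; rewrite -subr_ge0.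
have [|c cab ->] := @MVT_segment _ psi (fun u => w u ^+ k) a b ab _
  (@psi_cont_segment a b a0).
  by move=> u; rewrite in_itv/= => /andP[au _]; apply: is_derive_psi; exact: le_lt_trans au.
rewrite mulr_ge0 ?subr_ge0// exprn_ge0// ltW// w_gt0//.
by move: cab; rewrite in_itv/= => /andP[+ _]; exact: le_trans.
Qed.

Lemma is_derive_w (t : R) : 0 <= t -> is_derive t 1 w (2 * q t * w t).
Proof.
move=> t0; have := Dx t0; have := Dy t0 => ? ?.
by apply: is_derive_eq; rewrite /GRing.scale/= /w; ring.
Qed.

Lemma is_derive_wVj (t : R) : 0 <= t ->
  is_derive t 1 (fun u => (w u ^+ j)^-1) (- (m%:R * f (psi t) * w t ^+ k)).
Proof.
move=> t0; have := is_derive_w t0 => Dw.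
have w0 := w_gt0 t0.
have wj0 : w t ^+ j != 0 by rewrite expf_neq0// gt_eqF.
have Dwj : is_derive t 1 (fun u => w u ^+ j) (j%:R * w t ^+ j' * (2 * q t * w t)).
  by rewrite (_ : (fun u => w u ^+ j) = w ^+ j); [exact: is_deriveX|rewrite exprfctE].
have := is_deriveV (f := fun u => w u ^+ j) wj0 Dwj; congr is_derive.
rewrite /GRing.scale/= mulNr; congr (- _).
rewrite /q exprD {1}/m natrM.
rewrite (_ : _ * _ = (w t ^+ j) ^- 2 * (w t ^+ j * (w t ^+ j' * w t)) *
  (2 * j%:R * f (psi t) * w t ^+ k)); last by ring.
by rewrite -exprSr -expr2 mulVf ?mul1r// expf_neq0.
Qed.

(** By monotonicity [psi] is bounded below, so [|psi|] being unbounded forces [psi]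
itself to be unbounded above. *)
Lemma psi_onto phi : psi 0 <= phi -> exists2 t, 0 <= t & psi t = phi.
Proof.
move=> h; have [t t0 Bt] := psi_unbounded (`|psi 0| + `|phi|).
have ps : psi 0 <= psi t by exact: psi_nondecreasing.
have pt : phi <= psi t.
  apply: (le_trans (ler_norm phi)); move: Bt; rewrite ltr_normr => /orP[|] Bt.
    by have := normr_ge0 (psi 0); lra.
  by have := ler_norm (- psi 0); rewrite normrN; have := normr_ge0 phi; lra.
have [|c] := @IVT _ psi 0 t phi t0 (@psi_cont_segment 0 t (lexx _)).
  by rewrite ge_min h/= le_max pt orbT.
by rewrite in_itv/= => /andP[c0 _] <-; exists c.
Qed.

Lemma f_bound_ge0 : 0 <= Fm.
Proof. exact: le_trans (f_bound 0). Qed.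

(** Along the orbit [w ^ -j + m * G psi] is constant, [G] being an antiderivative of
[f]; so [w ^ -j] is the function [v = Cst - m * G] of the angle, and the
periodicity of [f] makes the increment of [v] over a turn constant. *)
Lemma inverse_radius : exists (v : R -> R) (kappa : R),
  [/\ 0 < kappa,
      forall t : R, 0 <= t -> v (psi t) = (w t ^+ j)^-1,
      forall phi, psi 0 <= phi -> v (phi + 2 * pi) = v phi + kappa &
      forall phi phi', psi 0 <= phi -> psi 0 <= phi' ->
        `|v phi - v phi'| <= m%:R * Fm * `|phi - phi'| ].
Proof.
have [G DG] := @continuous_antiderivative _ f (psi 0 - 1) f_cont.
have p1 phi : psi 0 <= phi -> psi 0 - 1 < phi.
  by apply: lt_le_trans; rewrite ltrBlDr ltrDl.
pose Cst := (w 0 ^+ j)^-1 + m%:R * G (psi 0).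
pose v phi := Cst - m%:R * G phi.
have Glip phi phi' : psi 0 <= phi -> psi 0 <= phi' ->
    `|G phi - G phi'| <= Fm * `|phi - phi'|.
  move=> h h'; apply: (lipschitz_of_derive DG) => //; [exact: p1|exact: p1].
have vlip phi phi' : psi 0 <= phi -> psi 0 <= phi' ->
    `|v phi - v phi'| <= m%:R * Fm * `|phi - phi'|.
  move=> h h'; rewrite (_ : v phi - v phi' = - (m%:R * (G phi - G phi'))); last first.
    by rewrite /v; ring.
  by rewrite normrN normrM normr_nat -mulrA ler_wpM2l// Glip.
have vw t : 0 <= t -> v (psi t) = (w t ^+ j)^-1.
  move=> t0; pose h u := (w u ^+ j)^-1 + m%:R * G (psi u).
  suff : `|h t - h 0| <= 0 * (t - 0).
    rewrite mul0r normr_le0 subr_eq0 => /eqP ht.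
    by rewrite /v /Cst -/(h 0) -ht /h; ring.
  apply: (@mean_value_bound _ h (fun=> 0)) => //.
  - move=> u /andP[u0 ut]; have Dw := is_derive_wVj (ltW u0).
    have Dp := is_derive_psi u0.
    have DGu : is_derive (psi u) 1 G (f (psi u)).
      by apply: DG; apply: p1; exact: psi_nondecreasing (ltW u0).
    have Dc : is_derive u 1 (G \o psi) (f (psi u) * w u ^+ k) by exact: is_derive1_comp.
    have Dz : is_derive u 1 (fun t => m%:R * G (psi t)) (m%:R * (f (psi u) * w u ^+ k)).
      exact: (is_deriveZ m%:R Dc).
    have := is_deriveD Dw Dz; congr is_derive.
    by rewrite mulrA addNr.
  - apply/subspace_continuousP => u /=; rewrite in_itv/= => /andP[u0 ut].
    apply: cvgD.
      apply: cvg_within_filter.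
      exact: is_derive_continuous (is_derive_wVj u0).
    apply: cvgM; first exact: cvg_cst.
    apply: (@cvg_comp _ _ _ psi G _ (nbhs (psi u))).
      have := @psi_cont_segment 0 t (lexx _) => /subspace_continuousP; apply.
      by rewrite /= in_itv/= u0.
    apply: (@is_derive_continuous _ G (psi u) (f (psi u))).
    by apply: DG; apply: p1; exact: psi_nondecreasing.
  - by move=> u _; rewrite normr0.
pose kappa := v (psi 0 + 2 * pi) - v (psi 0).
have p2 : 0 < 2 * pi :> R by rewrite mulr_gt0// pi_gt0.
have vturn phi : psi 0 <= phi -> v (phi + 2 * pi) = v phi + kappa.
  move=> h; pose D u := G (u + 2 * pi) - G u.
  have : `|D phi - D (psi 0)| <= 0 * `|phi - psi 0|.
    apply: (@lipschitz_of_derive _ D (fun=> 0) (psi 0 - 1)).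
    - move=> u hu; have DGu := DG _ hu.
      have DG2 : is_derive (u + 2 * pi) 1 G (f (u + 2 * pi)).
        by apply: DG; apply: (lt_trans hu); rewrite ltrDl.
      have Ds : is_derive u 1 (shift (2 * pi) : R -> R) 1 by exact: is_derive_shift.
      have Dc : is_derive u 1 (G \o shift (2 * pi)) (f (u + 2 * pi) * 1).
        exact: is_derive1_comp.
      have -> : D = (G \o shift (2 * pi)) - G by [].
      by apply: is_derive_eq; rewrite f_periodic mulr1 subrr.
    - by move=> u _; rewrite normr0.
    - exact: p1.
    - exact: p1.
  rewrite mul0r normr_le0 subr_eq0 => /eqP; rewrite /D => DE.
  rewrite /kappa /v.
  have -> : G (phi + 2 * pi) = G (psi 0 + 2 * pi) - G (psi 0) + G phi by lra.
  ring.
exists v, kappa; split=> //.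
(* Otherwise [v] would nowhere exceed its bound over the first turn, although the
   orbit comes arbitrarily close to the origin. *)
rewrite ltNge; apply/negP => k0.
have vturns n phi : psi 0 <= phi -> v (phi + 2 * pi * n%:R) <= v phi.
  move=> h; elim: n => [|n IH]; first by rewrite mulr0 addr0.
  apply: le_trans IH; rewrite -(natr1 n) mulrDr mulr1 addrA vturn; first by rewrite gerDl.
  by apply: (le_trans h); rewrite lerDl mulr_ge0// ltW.
pose vmax := v (psi 0) + m%:R * Fm * (2 * pi).
have vle phi : psi 0 <= phi -> v phi <= vmax.
  move=> h; have x0 : 0 <= (phi - psi 0) / (2 * pi).
    by rewrite divr_ge0 ?subr_ge0// ltW.
  have /andP[] := truncn_itv x0; set n := Num.truncn _.
  rewrite ler_pdivlMr// ltr_pdivrMr// -(natr1 n) mulrDl mul1r mulrC => n1 n2.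
  rewrite -(subrK (2 * pi * n%:R) phi).
  have h' : psi 0 <= phi - 2 * pi * n%:R by lra.
  apply: le_trans (vturns n _ h') _.
  have := vlip _ _ h' (lexx _); rewrite ler_distl => /andP[_] /le_trans; apply.
  rewrite lerD2l ler_wpM2l ?mulr_ge0 ?f_bound_ge0//.
  rewrite ger0_norm; lra.
have vmax0 : 0 < vmax.
  by apply: lt_le_trans (vle _ (lexx _)); rewrite vw// invr_gt0 exprn_gt0// w_gt0.
have [|t t0] := @w_small (Num.min 1 vmax^-1); first by rewrite lt_min ltr01 invr_gt0.
rewrite lt_min => /andP[wt1 wt2]; have w0 := w_gt0 t0.
have := vle _ (psi_nondecreasing (lexx _) t0); rewrite vw//; apply/negP; rewrite -ltNge.
rewrite -[ltLHS]invrK ltf_pV2 ?posrE ?invr_gt0 ?exprn_gt0//.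
apply: le_lt_trans wt2; rewrite /j exprS ler_piMr ?(ltW w0)// exprn_ile1// ltW//.
Qed.

(** As [psi] takes every value from [psi 0] on, the orbit is the spiral of radius
[v ^ (- 1 / m)], to which [spiral_box_dim] applies. *)
Lemma orbit_box_dim :
  let Gamma := [set (x t, e * y t) | t in [set t : R | 0 <= t]] in
  has_box_dim Gamma (2 - 2 / m.+1%:R) /\ minkowski_nondegenerate Gamma.
Proof.
have [v [kappa [kappa0 vw vturn vlip]]] := inverse_radius.
pose rho phi := v phi `^ (- (m%:R)^-1).
have W0 : 0 < W by apply: lt_le_trans (w_gt0 (lexx 0)) (w_bound (lexx 0)).
have vge phi : psi 0 <= phi -> (W ^+ j)^-1 <= v phi.
  move=> /psi_onto[t t0 <-]; rewrite vw// lef_pV2 ?posrE ?exprn_gt0 ?w_gt0//.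
  by rewrite lerXn2r ?nnegrE ?w_bound ?(ltW W0) ?(ltW (w_gt0 t0)).
have q0 : 0 < (W ^+ j)^-1 by rewrite invr_gt0 exprn_gt0.
have v_gt0 phi : psi 0 <= phi -> 0 < v phi by move=> /vge; exact: lt_le_trans.
have rho_gt0 phi : psi 0 <= phi -> 0 < rho phi by move=> /v_gt0 h; exact: powR_gt0.
have m0 : (0 < m)%N by rewrite /m mul2n double_gt0.
have rho_v phi : psi 0 <= phi -> rho phi ^+ m * v phi = 1.
  move=> h; rewrite -powR_mulrn ?powR_ge0// /rho -powRrM mulNr mulVf ?pnatr_eq0 -?lt0n//.
  by rewrite powR_inv1 ?(ltW (v_gt0 _ h))// mulVf// gt_eqF// v_gt0.
have rhoE t : 0 <= t -> rho (psi t) = Num.sqrt (w t).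
  move=> t0; have pt := psi_nondecreasing (lexx _) t0.
  have w0 := w_gt0 t0.
  apply/eqP; rewrite -(eqrXn2 m0) ?(ltW (rho_gt0 _ pt)) ?sqrtr_ge0//; apply/eqP.
  rewrite {2}/m exprM sqr_sqrtr ?(ltW w0)//.
  have := rho_v _ pt; rewrite vw// => /(canRL (divfK _)) ->.
    by rewrite mul1r.
  by rewrite expf_neq0// gt_eqF.
move=> Gamma.
have -> : Gamma = spiral e (psi 0) rho.
  apply/seteqP; split=> [_ [t /= t0 <-]|_ [phi /= h <-]].
    exists (psi t); first exact: psi_nondecreasing.
    by rewrite rhoE// -xE// -yE.
  by have [t t0 <-] := psi_onto h; exists t => //; rewrite rhoE// -xE// -yE.
apply: (@spiral_box_dim _ j' e (psi 0) kappa (m%:R * Fm) (W ^+ j)^-1 v rho) => //.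
by rewrite mulr_ge0// f_bound_ge0.
Qed.
End polar_flow.

(** * The homogeneous polynomial on rays and on the unit circle *)

Section eval2.
Variable R : realType.
Variable P : mpoly.mpoly 2 R.

Lemma eval2E (x y : R) : eval2 P x y = \sum_(m <- mpoly.msupp P)
  mpoly.mcoeff m P * (x ^+ mpoly.fun_of_multinom m ord0 *
    y ^+ mpoly.fun_of_multinom m (lift ord0 ord0)).
Proof.
rewrite /eval2 mpoly.mevalE; apply: eq_bigr => m _.
by rewrite big_ord_recl big_ord1.
Qed.

Lemma eval2_homogeneous (s : nat) (r x y : R) : homogeneous s P ->
  eval2 P (r * x) (r * y) = r ^+ s * eval2 P x y.
Proof.
move=> /mpoly.dhomogP homP; rewrite !eval2E mulr_sumr.
rewrite big_seq [RHS]big_seq; apply: eq_bigr => m mP.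
have dE : mdeg m = (m ord0 + m (lift ord0 ord0))%N by rewrite mdegE big_ord_recl big_ord1.
have -> : s = (m ord0 + m (lift ord0 ord0))%N by rewrite -(homP m mP); exact: dE.
by rewrite exprD !exprMn; ring.
Qed.

Lemma continuous_eval2 (c s : R -> R) : continuous c -> continuous s ->
  continuous (fun phi => eval2 P (c phi) (s phi)).
Proof.
move=> cc cs; pose F (l : seq (multinom 2)) (phi : R) := \sum_(m <- l)
  mcoeff m P * (c phi ^+ m ord0 * s phi ^+ m (lift ord0 ord0)).
suff H l : continuous (F l).
  by rewrite (_ : (fun _ => _) = F (msupp P))//; apply/funext => phi; rewrite eval2E.
elim: l => [|m l IH] phi.
  by rewrite (_ : F [::] = cst 0); [exact: cvg_cst|apply/funext => t; rewrite /F big_nil].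
rewrite (_ : F (m :: l) = fun phi =>
    mcoeff m P * (c phi ^+ m ord0 * s phi ^+ m (lift ord0 ord0)) + F l phi); last first.
  by apply/funext => t; rewrite /F big_cons.
apply: cvgD; last exact: IH.
apply: cvgM; first exact: cvg_cst.
apply: cvgM.
  exact: (continuous_comp (cc phi) (@exprn_continuous _ _ _)).
exact: (continuous_comp (cs phi) (@exprn_continuous _ _ _)).
Qed.

Lemma eval2_bounded : exists B : R, forall x y : R, `|x| <= 1 -> `|y| <= 1 ->
  `|eval2 P x y| <= B.
Proof.
exists (\sum_(m <- mpoly.msupp P) `|mpoly.mcoeff m P|) => x y x1 y1.
rewrite eval2E; apply: (le_trans (ler_norm_sum _ _ _)); apply: ler_sum => m _.
rewrite normrM ler_piMr// normrM !normrX.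
by rewrite mulr_ile1 ?exprn_ge0// exprn_ile1.
Qed.
End eval2.

(** * Half-trajectories parametrized by the elapsed time *)

Section half_trajectory.
Variable R : realType.

Definition time_sign (fwd : bool) : R := if fwd then 1 else -1.

Lemma sqr_time_sign fwd : time_sign fwd ^+ 2 = 1.
Proof. by case: fwd; rewrite /= ?sqrrN expr1n. Qed.

Lemma time_rayP fwd (t0 t : R) :
  time_ray fwd t0 t <-> 0 <= time_sign fwd * (t - t0).
Proof.
by case: fwd; rewrite /time_ray /= in_itv/= ?andbT; split;
  rewrite ?mul1r ?mulN1r ?opprB subr_ge0.
Qed.

Lemma time_ray_elapsed fwd (t0 tau : R) : 0 <= tau ->
  time_ray fwd t0 (t0 + time_sign fwd * tau).
Proof.
by move=> h; apply/time_rayP; rewrite addrC addKr mulrA -expr2 sqr_time_sign mul1r.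
Qed.

Lemma time_end_ex fwd (t0 : R) (P : R -> Prop) :
  (\forall t \near time_end fwd, P t) ->
  exists2 tau, 0 <= tau & P (t0 + time_sign fwd * tau).
Proof.
case: fwd => /= nP.
- have [t [Pt t0t]] : exists t, P t /\ t0 <= t.
    apply: (@filter_ex _ (pinfty_nbhs R)); apply: filterI => //.
    by apply: nbhs_pinfty_ge; exact: num_real.
  by exists (t - t0); rewrite ?subr_ge0// mul1r addrC subrK.
- have [t [Pt t0t]] : exists t, P t /\ t <= t0.
    apply: (@filter_ex _ (ninfty_nbhs R)); apply: filterI => //.
    by apply: nbhs_ninfty_le; exact: num_real.
  by exists (t0 - t); rewrite ?subr_ge0// mulN1r opprB addrC subrK.
Qed.

Lemma cos_time_sign fwd (a : R) : cos (time_sign fwd * a) = cos a.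
Proof. by case: fwd; rewrite /= ?mul1r// mulN1r cosN. Qed.

Lemma sin_time_sign fwd (a : R) : sin (time_sign fwd * a) = time_sign fwd * sin a.
Proof. by case: fwd; rewrite /= ?mul1r// !mulN1r sinN. Qed.

Lemma bounded_set_coord (A : set (R * R)) : bounded_set A ->
  exists M, forall p, A p -> `|p.1| <= M /\ `|p.2| <= M.
Proof.
move=> [M [_ HM]]; exists (M + 1) => p Ap.
have : `|p| <= M + 1 by apply: HM => //; rewrite ltrDl.
by rewrite prod_normE ge_max => /andP[].
Qed.
End half_trajectory.

Theorem proposition1 (R : realType) (s k : nat) (Rs : mpoly.mpoly 2 R)
    (Gamma : set (R * R)) :
  ~~ odd s -> (2 * k < s)%N ->
  homogeneous s Rs ->
  spiral_trajectory (planar_field k Rs) Gamma ->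
  has_box_dim Gamma (2 - 2 / (s%:R - 2 * k%:R + 1)) /\
  minkowski_nondegenerate Gamma.
Proof.
move=> s_even ks homRs [_ [fwd [t0 [g [sol GammaE _ bnd [g_to0 [g_neq0 [theta]]]]]]]].
move=> [theta_cont gE theta_oo].
pose e : R := time_sign R fwd.
have e2 : e ^+ 2 = 1 by exact: sqr_time_sign.
have eK (a : R) : e * (e * a) = a by rewrite mulrA -expr2 e2 mul1r.
have e1 : `|e| = 1.
  by apply/eqP; rewrite -sqr_norm_eq1 e2.
have Ft : Filter (time_end (R := R) fwd) by case: (fwd) => /=; exact: _.
(* [s - 2 * k] is [2 * j'.+1], which is where the parity of [s] enters. *)
pose j' := (s./2 - k).-1.
have jE : (j'.+1 + k = s./2)%N.
  have kh : (k < s./2)%N by rewrite -ltn_double even_halfK// -mul2n.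
  by rewrite prednK ?subn_gt0// subnK// ltnW.
have sE : (2 * (j'.+1 + k) = s)%N by rewrite jE mul2n even_halfK.
have -> : s%:R - 2 * k%:R + 1 = (2 * j'.+1).+1%:R :> R.
  by rewrite -sE -[in RHS]natr1 !natrM natrD; ring.
pose T (tau : R) := t0 + e * tau.
have Tray (tau : R) : 0 <= tau -> time_ray fwd t0 (T tau) by exact: time_ray_elapsed.
(* The second coordinate and the angle are multiplied by [e], so that the angle
   increases with [tau] in both time directions; [f] is the angular factor of the
   radial speed in these coordinates. *)
pose x tau := (g (T tau)).1.
pose y tau := e * (g (T tau)).2.
pose psi tau := e * theta (T tau).
pose f phi := e * eval2 Rs (cos phi) (e * sin phi).
pose w tau := x tau ^+ 2 + y tau ^+ 2.
have wE tau : w tau = (g (T tau)).1 ^+ 2 + (g (T tau)).2 ^+ 2.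
  by rewrite /w /y exprMn e2 mul1r.
have gxy (tau : R) : 0 <= tau -> (g (T tau)).1 = Num.sqrt (w tau) * cos (psi tau) /\
    (g (T tau)).2 = Num.sqrt (w tau) * (e * sin (psi tau)).
  move=> tau0; have -> : Num.sqrt (w tau) = enorm (g (T tau)) by rewrite wE.
  rewrite -sin_time_sign -/e -(cos_time_sign fwd) -/e eK.
  by have := gE _ (Tray _ tau0) => /[dup] /(congr1 fst) /= ? /(congr1 snd).
have w_gt0 (tau : R) : 0 <= tau -> 0 < w tau.
  move=> /Tray/g_neq0 gn0; rewrite wE lt_neqAle addr_ge0 ?sqr_ge0// andbT eq_sym.
  rewrite paddr_eq0 ?sqr_ge0// !sqrf_eq0; apply/negP => /andP[/eqP g1 /eqP g2].
  by apply: gn0; rewrite [g _]surjective_pairing g1 g2.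
have radial (tau : R) : 0 <= tau -> e * eval2 Rs (g (T tau)).1 (g (T tau)).2 =
    w tau ^+ (j'.+1 + k) * f (psi tau).
  move=> tau0; have [-> ->] := gxy _ tau0; rewrite (eval2_homogeneous _ _ _ homRs).
  by rewrite -{1}sE exprM sqr_sqrtr ?(ltW (w_gt0 _ tau0))// /f; ring.
have DT (tau : R) : is_derive tau 1 T e.
  have := is_deriveD (is_derive_cst t0 tau 1) (is_deriveZ e (is_derive_id tau 1)).
  by congr is_derive; rewrite add0r; exact: mulr1.
have [B fB] := eval2_bounded Rs.
have [M GM] := bounded_set_coord bnd.
have GammaE' : Gamma = [set (x tau, e * y tau) | tau in [set tau : R | 0 <= tau]].
  rewrite GammaE; apply/seteqP; split=> [_ [t tr <-]|_ [tau /= tau0 <-]].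
    exists (e * (t - t0)); first exact/time_rayP.
    by rewrite /x /y /T !eK addrC subrK -surjective_pairing.
  by exists (T tau); [exact: Tray|rewrite /x /y eK -surjective_pairing].
rewrite {1 2}GammaE'.
apply: (@orbit_box_dim R j' k e (2 * M ^+ 2) B x y psi f) => //.
- move=> tau tau0; have [D1 _] := sol _ (Tray _ tau0).
  have := is_derive1_comp D1 (DT tau); congr is_derive.
  rewrite -/(w tau) -radial// /x /y wE.
  by case: (g (T tau)) => a b /=; ring.
- move=> tau tau0; have [_ D2] := sol _ (Tray _ tau0).
  have := is_derive1_comp D2 (DT tau) => Dc.
  have -> : y = e *: ((fun u => (g u).2) \o T) by [].
  apply: is_derive_eq.
  rewrite -/(w tau) -radial// /GRing.scale/= [_ * e]mulrC eK /x /y wE.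
  by move: e2; case: (g (T tau)) => a b /= e2'; rewrite [e * b * _]mulrACA -expr2 e2'; ring.
- apply/subspace_continuousP => tau; rewrite /= in_itv/= andbT => tau0.
  apply: cvgM; first exact: cvg_cst.
  apply: (@cvg_comp _ _ _ T theta _ (within (time_ray fwd t0) (nbhs (T tau)))).
    move=> A /= nA.
    have cT : T u @[u --> tau] --> T tau by exact: is_derive_continuous (DT tau).
    have nA' : nbhs (T tau) (fun t => time_ray fwd t0 t -> A t) := nA.
    apply: (@filterS _ (nbhs tau) _ _ _ _ (cT _ nA')) => u /= Au.
    rewrite in_itv/= andbT => u0.
    by apply: Au; exact: Tray.
  by move/subspace_continuousP : theta_cont; apply; exact: Tray.
- by move=> tau tau0; have [] := gxy _ tau0.
- by move=> tau tau0; have [_ gy] := gxy _ tau0; rewrite -/(w tau) {1}/y gy mulrCA eK.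
- move=> phi; apply: cvgM; first exact: cvg_cst.
  have cs : continuous (fun a => e * sin a).
    by move=> a; apply: cvgM; [exact: cvg_cst|exact: continuous_sin].
  exact: (@continuous_eval2 _ Rs _ _ (@continuous_cos R) cs phi).
- move=> phi; rewrite normrM.
  rewrite e1 mul1r; apply: fB; first by rewrite ler_norml cos_geN1 cos_le1.
  by rewrite normrM e1 mul1r ler_norml sin_geN1 sin_le1.
- by move=> phi; rewrite /f mulr_natl cosD2pi sinD2pi.
- move=> tau tau0; have [|] := GM (g (T tau)).
    by rewrite GammaE; exists (T tau) => //; exact: Tray.
  rewrite -/(w tau) wE; set a := (g _).1; set b := (g _).2 => a1 b1.
  rewrite -(real_normK (num_real a)) -(real_normK (num_real b)) mulr_natl mulr2n.
  by apply: lerD; rewrite lerXn2r ?nnegrE// (le_trans _ a1).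
- move=> d d0.
  pose h := Num.min 1 (d / 2).
  have h0 : 0 < h by rewrite lt_min ltr01 divr_gt0.
  have [h1 hd] : h <= 1 /\ h <= d / 2 by rewrite !ge_min !lexx orbT.
  have near0 : \forall t \near time_end fwd, `|(0, 0) - g t| < h.
    by have /cvgrPdist_lt /(_ _ h0) := g_to0.
  have [tau tau0] := time_end_ex t0 near0; rewrite -/e -/(T tau) => gh.
  exists tau => //; rewrite -/(w tau) wE.
  move: gh; rewrite prod_normE gt_max /= !sub0r !normrN => /andP[].
  set a := (g _).1; set b := (g _).2 => ah bh.
  rewrite -(real_normK (num_real a)) -(real_normK (num_real b)).
  have := normr_ge0 a; have := normr_ge0 b; nra.
- move=> C.
  have nearC : \forall t \near time_end fwd, C < `|theta t|.
    by have /cvgryPgt := theta_oo; apply.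
  have [tau tau0] := time_end_ex t0 nearC; rewrite -/e -/(T tau) => Ct.
  by exists tau => //; rewrite normrM e1 mul1r.
Qed.
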